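(* Fix an integer $d>1$. Let $P$ be a $d$-dimensional $2$-level polytope that is not affinely isomorphic to the $d$-dimensional cube or to the $d$-dimensional cross-polytope. Then \[ f_0(P)\cdot f_{d-1}(P)\le (d-1)\,2^{d+1}+8(d-1). \]
   Context: A polytope $P$ is called $2$-level if for every facet-defining hyperplane $H$ of $P$ there is a hyperplane $H'$ parallel to $H$ such that $H\cup H'$ contains all vertices of $P$. For a $d$-dimensional polytope $P$, $f_0(P)$ denotes its number of vertices and $f_{d-1}(P)$ its number of facets. *)

(* Defs.v *)
From mathcomp Require Import all_boot all_order all_algebra finmap.
From mathcomp Require Import boolp classical_sets functions cardinality reals.

Set Implicit Arguments.
Unset Strict Implicit.
Unset Printing Implicit Defensive.

Import Order.TTheory GRing.Theory Num.Theory.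

Local Open Scope classical_set_scope.
Local Open Scope ring_scope.

Section Polytopes.
Context {R : realType}.

Section Ambient.
Context {n : nat}.
Implicit Types (A P F H : set 'rV[R]_n) (v x c : 'rV[R]_n) (b : R) (d : nat).

Definition dot c x : R := \sum_i c 0 i * x 0 i.

Definition convex_hull A : set 'rV[R]_n :=
  [set y | exists k (w : 'I_k -> R) (x : 'I_k -> 'rV[R]_n),
    [/\ forall i, A (x i), forall i, 0 <= w i, \sum_i w i = 1
      & y = \sum_i w i *: x i]].

Definition affine_hull A : set 'rV[R]_n :=
  [set y | exists k (w : 'I_k -> R) (x : 'I_k -> 'rV[R]_n),
    [/\ forall i, A (x i), \sum_i w i = 1 & y = \sum_i w i *: x i]].

(* The dimension of a set is that of its affine hull; it is a relation because
   the empty set has no dimension in nat. *)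
Definition has_dim A d : Prop :=
  exists (x0 : 'rV[R]_n) (U : {vspace 'rV[R]_n}),
    \dim U = d /\ affine_hull A = [set x0 + u | u in [set u | u \in U]].

Definition polytope P : Prop := exists2 V, finite_set V & P = convex_hull V.

(* The inequality may be degenerate (c = 0), so that P and set0 are faces. *)
Definition face P F : Prop :=
  exists c b, (forall x, P x -> dot c x <= b) /\
    F = P `&` [set x | dot c x = b].

Definition facet P F : Prop :=
  face P F /\ exists d, has_dim P d.+1 /\ has_dim F d.

Definition vertices P : set 'rV[R]_n := [set v | face P [set v]].

Definition facets P : set (set 'rV[R]_n) := [set F | facet P F].

Definition hyperplane H : Prop :=
  exists c b, c != 0 /\ H = [set x | dot c x = b].

Definition parallel H H' : Prop := exists v, H' = [set x + v | x in H].

(* P may have positive codimension in 'rV_n. A facet F then lies in many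
   hyperplanes H with P `&` H = F, and all of them are considered. *)
Definition facet_defining P H : Prop := hyperplane H /\ facet P (P `&` H).

Definition two_level P : Prop :=
  forall H, facet_defining P H ->
    exists H', [/\ hyperplane H', parallel H H'
                 & vertices P `<=` H `|` H'].

(* fset_set is fset0 on infinite sets, a case excluded for polytopes by
   finite_vertices and finite_facets. *)
Definition num_vertices P : nat := #|` fset_set (vertices P)|.

Definition num_facets P : nat := #|` fset_set (facets P)|.

End Ambient.

Definition affinely_isomorphic n m (P : set 'rV[R]_n) (Q : set 'rV[R]_m) :
    Prop :=
  exists (A : 'M[R]_(n, m)) (b : 'rV[R]_m),
    set_bij P Q (fun x => x *m A + b).

Definition cube d : set 'rV[R]_d := [set x | forall i, 0 <= x 0 i <= 1].

Definition cross_polytope d : set 'rV[R]_d :=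
  convex_hull [set x | exists i, x = delta_mx 0 i \/ x = - delta_mx 0 i].

Section Finiteness.
Context {n : nat}.
Implicit Types (V P F : set 'rV[R]_n).

Lemma dot_sum (c : 'rV[R]_n) k (w : 'I_k -> R) (x : 'I_k -> 'rV[R]_n) :
  dot c (\sum_i w i *: x i) = \sum_i w i * dot c (x i).
Proof.
rewrite /dot; under [RHS]eq_bigr do rewrite mulr_sumr.
rewrite exchange_big; apply: eq_bigr => j _ /=.
rewrite summxE mulr_sumr; apply: eq_bigr => i _.
by rewrite mxE mulrCA.
Qed.

Lemma sub_convex_hull V : V `<=` convex_hull V.
Proof.
move=> x Vx; exists 1, (fun=> 1), (fun=> x).
by split=> //; rewrite big_ord1 ?scale1r.
Qed.

Lemma convex_hull_mono V W : V `<=` W -> convex_hull V `<=` convex_hull W.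
Proof.
move=> VW x [k [w [y [Vy w0 w1 ->]]]]; exists k, w, y; split=> // i.
exact: VW.
Qed.

Lemma face_convex_hull V F :
  face (convex_hull V) F -> F = convex_hull (V `&` F).
Proof.
move=> [c [b [le_b ->]]]; apply/seteqP; split; last first.
  move=> x hx; split.
    by apply: convex_hull_mono hx => y [].
  case: hx => k [w [y [Vy w0 w1 ->]]] /=.
  rewrite dot_sum -[RHS]mul1r -w1 mulr_suml; apply: eq_bigr => i _.
  by case: (Vy i) => _ [_ /= ->].
move=> x [[k [w [y [Vy w0 w1 ->]]]] /=]; rewrite dot_sum => eq_b.
have le_y i : dot c (y i) <= b by apply: le_b; apply: sub_convex_hull.
have slack i : w i * (b - dot c (y i)) = 0.
  have : \sum_i w i * (b - dot c (y i)) == 0.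
    under eq_bigr do rewrite mulrBr.
    by rewrite sumrB -mulr_suml w1 mul1r eq_b subrr.
  rewrite psumr_eq0 => [/allP/(_ i (mem_index_enum _))/eqP //|j _].
  by rewrite mulr_ge0 ?w0 ?subr_ge0.
have [i0 wi0] : exists i, w i != 0.
  apply/not_existsP => w_eq0; have /eqP := w1; rewrite big1 ?(eq_sym 0) ?oner_eq0//.
  by move=> i _; apply/eqP/negPn/negP; apply: w_eq0.
have tight i : w i != 0 -> dot c (y i) = b.
  move=> wi; have /eqP := slack i.
  by rewrite mulf_eq0 (negbTE wi) subr_eq0 => /eqP.
pose z i := if w i == 0 then y i0 else y i.
exists k, w, z; split=> //.
  move=> i; rewrite /z; case: eqVneq => [_|wi]; split=> //;
    by split; [exact: sub_convex_hull | exact: tight].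
by apply: eq_bigr => i _; rewrite /z; case: eqVneq => // ->; rewrite !scale0r.
Qed.

Lemma finite_faces P : polytope P -> finite_set [set F | face P F].
Proof.
move=> [V finV ->].
pose f (s : {fset 'rV[R]_n}) := convex_hull [set` s].
apply: (@sub_finite_set _ _ (f @` [set` fpowerset (fset_set V)])); last first.
  exact: finite_image.
move=> F /face_convex_hull FE.
have finVF : finite_set (V `&` F) by apply: sub_finite_set finV => x [].
exists (fset_set (V `&` F)); last by rewrite /f fset_setK.
rewrite /= fpowersetE -fset_set_sub//.
Qed.

Lemma finite_vertices P : polytope P -> finite_set (vertices P).
Proof.
move=> /finite_faces finP.
have -> : vertices P = set1 @^-1` [set F | face P F] by [].
apply: finite_preimage => // x y _ _ xy.
have : [set y] x by rewrite -xy.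
by [].
Qed.

Lemma finite_facets P : polytope P -> finite_set (facets P).
Proof. by move=> /finite_faces; apply: sub_finite_set => F []. Qed.

End Finiteness.
End Polytopes.

Arguments cube R d : clear implicits.
Arguments cross_polytope R d : clear implicits.

(* Main.v *)
Require Import Defs.
From mathcomp Require Import all_boot all_order all_algebra.
From mathcomp Require Import zify ring lra.

(** Let A be the vertex set of a d-dimensional 2-level polytope P and V the space of
    restrictions to A of affine functions, so that dim V = d + 1. Facets of P are
    minimal nonzero 0/1-valued functions in V. Choose a facet with the largest
    number p of vertices. The other level of its function has at most p vertices,
    as it lies in a facet as well, so f_0 <= 2 p; and since two 0/1-valued functions
    with the same restriction to this facet yield at most one further facet, the
    number of facets is at most the number r of 0/1-valued functions in the space
    of the facet. The bound on 2 p r comes from the inequality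
    |A| |B| <= d 2^(d+1) + 4 d for the set B of all 0/1-valued functions in V, valid
    if |A| >= d + 2 and |B| >= 2 d + 4, applied in dimension d - 1. That inequality is
    proved by induction on d with the same cut: if q vertices lie off the largest
    facet and s functions of B vanish at all of them, then q s <= 2^d, and
    (p + q) (r + s) = 2 (p r + q s) - (p - q) (r - s).
    When its hypotheses fail, the largest facet is a simplex or it has few 0/1-valued
    functions; either P is the cross-polytope or the cube, or a direct estimate
    is enough. *)

Set Implicit Arguments.
Unset Strict Implicit.
Unset Printing Implicit Defensive.

Import Order.TTheory GRing.Theory Num.Theory.

(** * Arithmetic *)

(** Restriction of V to the vertices off the largest facet has some rank e and a kernel of dimension
    j with j + e = d + 1; as q <= 2^(e-1) and s <= 2^j, this gives q s <= 2^d. With the induction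
    hypothesis for p r it yields 2 (p r + q s) <= d 2^(d+1) + 8 (d - 1), which is 4 (d - 2) too
    much. Two mechanisms make up for it. If q s loses a factor 3/4, then 2 q s drops by 2^(d-1),
    which suffices; this factor comes from a linear form with two nonzero coefficients, which cannot
    take values in {0, 1} at all four choices of the two coordinates. Otherwise enough functions
    take both values off the facet to make (p - q) (r - s) at least 4 (d - 2). The argument is
    stated for spaces of functions because the induction counts all 0/1-valued functions, and the
    cone condition in [binary_space] passes directly to facets. *)

Lemma exp2_ge8 d : 8 * d <= 2 ^ d + 16.
Proof.
elim: d => // -[|[|[|[|d]]]] //; rewrite [2 ^ _.+1]expnS => IH.
have := expn_gt0 2 d; rewrite !expnS in IH *; lia.
Qed.

(** The case p = d of a simplex facet, where r <= 2^d. Multiplied by q, the left side is at most (d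
    + q) (q + 1) 2^d, because q s <= 2^d; the comparison with 2 d q 2^d fails only for q = 2 and d =
    4 or 5. *)
Lemma arith_simplex d q s : 2 <= q -> 2 * q <= d -> q * s <= 2 ^ d ->
  (d + q) * (2 ^ d + s) <= d * 2 ^ d.+1 + 4 * d.
Proof.
move=> q2 qd qs; rewrite -(@leq_pmul2l q); last by lia.
have h1 : q * ((d + q) * (2 ^ d + s)) <= (d + q) * (q + 1) * 2 ^ d by nia.
apply: leq_trans h1 _; rewrite expnS.
case: (leqP ((d + q) * (q + 1)) (2 * d * q)) => [h|].
  have := leq_mul h (leqnn (2 ^ d)); lia.
case: (leqP 3 q) => q3 h; first by nia.
have {q2 q3}q2 : q = 2 by lia.
rewrite {}q2 in qd qs h *.
have : d = 4 \/ d = 5 by lia.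
by case=> ->.
Qed.

(** The case of at most 2 d sets on the facet, for d = j + m: with p <= 2^(d-1), q <= 2^m, r <= 2 d
    and s <= 2 j, the product bound reduces to this after cancellation. *)
Lemma arith_cube m j : 2 <= j ->
  2 ^ m * (m + 2 * j) <= m * 2 ^ m * 2 ^ j.-1 + 2 * (m + j).
Proof.
case: j => [|[|[|[|j]]]] //= _.
- case: m => [|[|[|[|m]]]] //=.
  by rewrite expn1 [m.+4 * _ * 2]mulnAC; set M := 2 ^ _; nia.
- case: m => [|[|m]] //=; set M := 2 ^ _.
  by rewrite (_ : 2 ^ 2 = 4)//; nia.
- case: m => [|m] /=; first by lia.
  have T : 2 * j.+4 <= 2 ^ j.+3.
    by elim: j => //= j IH; rewrite expnS; lia.
  have M2 : 2 <= 2 ^ m.+1 by rewrite expnS; have := expn_gt0 2 m; lia.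
  set M := 2 ^ m.+1 in M2 *; set U := 2 ^ _ in T *.
  case: m @M M2 => [|m] M M2; first by rewrite /M expn1; lia.
  have : m.+2 + 2 * j.+4 <= m.+2 * U by nia.
  by move=> /(leq_mul (leqnn M)); nia.
Qed.

(** With d = j + l and N = r - s, the term (p - q) N covers the excess 4 (d - 2). A small m makes p
    large by 2 j <= p + m, and a large m makes N large. *)
Lemma arith_cross j l m p q N : 1 < j -> 0 < l -> 2 * q <= p -> q <= 2 ^ l ->
  j + l < p -> 2 * j <= p + m -> 2 ^ m * (2 * l) <= N ->
  4 * (j + l) <= (p - q) * N + 8.
Proof.
move=> j1 l0 qp ql dp jp hN.
case: m jp hN => [|[|m]] jp hN.
- have {}hN : 2 * l <= N by lia.
  case: l l0 ql dp hN => [|[|l]] // _ ql dp hN.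
    by have := leq_mul (leqnn (p - q)) hN; rewrite expn1 in ql; lia.
  have : j * (2 * l.+2) <= (p - q) * N by apply: leq_mul; lia.
  by nia.
- have {}hN : 4 * l <= N by lia.
  case: l l0 ql dp hN => [|[|l]] // _ ql dp hN.
    by have := leq_mul (leqnn (p - q)) hN; rewrite expn1 in ql; lia.
  have : (p - q) * 8 <= (p - q) * N by apply: leq_mul; lia.
  by lia.
- have {}hN : 8 <= N.
    by apply: leq_trans hN; rewrite !expnS; have := expn_gt0 2 m; nia.
  have : (p - q) * 8 <= (p - q) * N by apply: leq_mul; lia.
  by lia.
Qed.

(* In the notation of the section Facet: p = |A0|, q = |b|, r and s count the sets
   not containing b and those disjoint from b, r0 those of V0, N the crossing
   ones; j = dim VX, e = dim Vb and m = |free_points|. The argument rests on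
   (p + q) (r + s) + (p - q) (r - s) = 2 (p r + q s). *)
Lemma arith_product d p q r s r0 j e m N :
  0 < d -> 0 < q -> d + 2 <= p + q -> 2 * d + 4 <= r + s -> d <= p ->
  r <= r0 -> r0 <= 2 ^ d -> 2 * p <= 2 ^ d -> q <= p ->
  (2 < s -> 2 * q <= p) -> 2 * q <= 2 ^ e -> j + e = d.+1 -> s <= 2 ^ j ->
  r = N + s -> 2 ^ m * (2 * e.-1) <= N ->
  8 * p <= 3 * 2 ^ d \/ r0 <= 2 * d -> 4 * r0 <= 3 * 2 ^ d \/ p <= d ->
  4 * s <= 3 * 2 ^ j \/ 2 * j <= p + m ->
  (r0 <= 2 * d -> s <= 2 * j) -> r0 <= 2 * d \/ 2 * d.+1 <= r0 ->
  (d < p -> 2 * d.+1 <= r0 -> p * r0 <= d.-1 * 2 ^ d + 4 * d.-1) ->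
  (p + q) * (r + s) <= d * 2 ^ d.+1 + 4 * d.
Proof.
move=> d0 q0 hA hB dp rr r0d pd qp sqp qe je sj rN hN dichP dichE dichX sX par IH.
have e8 := exp2_ge8 d.
have [l el] : exists l, e = l.+1.
  by case: e qe {je hN} => [|l] qe; [move: qe; rewrite expn0; lia | exists l].
move: qe hN je; rewrite {}el /= expnS => qe hN je.
have ql : q <= 2 ^ l by lia.
have dE : d = j + l by lia.
have qs : q * s <= 2 ^ d by rewrite dE expnD mulnC leq_mul.
have IH' : d < p -> 2 * d.+1 <= r0 -> p * r + 2 ^ d + 4 <= d * 2 ^ d + 4 * d.
  move=> h1 h2; have := IH h1 h2; have : p * r <= p * r0 by rewrite leq_mul.
  by case: (d) d0 => //= d' _; lia.
(* With s <= 2 only q <= p is known, but 2 p (r + 2) is small enough. *)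
have [s2|s2] := leqP s 2.
  have r0d2 : 2 * d.+1 <= r0 by lia.
  have [pd'|dp'] := leqP p d.
    have : (p + q) * (r + s) <= (2 * d) * (2 ^ d + 2) by apply: leq_mul; lia.
    by rewrite expnS; lia.
  have {dichP} : 8 * p <= 3 * 2 ^ d by case: dichP => //; lia.
  have := IH' dp' r0d2.
  have : (p + q) * (r + s) <= (2 * p) * (r + 2) by apply: leq_mul; lia.
  by rewrite expnS; lia.
have {}sqp := sqp s2.
have j2 : 1 < j.
  by case: j sj {dE je dichX sX} => [|[|j]]//; rewrite ?expn0 ?expn1; lia.
have [pd'|dp'] := leqP p d.
  have pE : p = d by lia.
  have : (p + q) * (r + s) <= (d + q) * (2 ^ d + s) by apply: leq_mul; lia.
  by move=> /leq_trans; apply; apply: arith_simplex => //; lia.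
case: par => r0d2.
  have {sX}sX := sX r0d2.
  have h := arith_cube l j2.
  have p2 : p <= 2 ^ l * 2 ^ j.-1.
    by rewrite -(@leq_pmul2l 2)// -expnD -expnS (_ : (_ + _).+1 = d)//; lia.
  have : (p + q) * (r + s) <= (2 ^ l * 2 ^ j.-1 + 2 ^ l) * (2 * d + 2 * j).
    by apply: leq_mul; lia.
  have -> : 2 ^ d.+1 = 4 * (2 ^ l * 2 ^ j.-1).
    by rewrite -expnD -(expnD 2 2); congr (2 ^ _); lia.
  move: h; rewrite dE -mulnA.
  by move: (2 ^ l) (2 ^ j.-1) => M T; clear; lia.
have {IH IH'}IH := IH' dp' r0d2.
have main : (p + q) * (r + s) + (p - q) * N = 2 * (p * r) + 2 * (q * s).
  by rewrite rN -{1 3}(subnK qp); lia.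
(* The saving of 2^(d-1) on 2 q s covers 4 (d - 2) by [exp2_ge8]. *)
have small : 4 * (q * s) <= 3 * 2 ^ d -> (p + q) * (r + s) <= d * 2 ^ d.+1 + 4 * d.
  by move=> h; rewrite expnS; lia.
case: dichX => [h|h].
  by apply: small; have := leq_mul ql h; rewrite dE expnD; lia.
(* A single vertex off the facet: q s = s <= r0, and r0 itself carries the factor 3/4. *)
case: (posnP l) => l0.
  apply: small; move: ql; rewrite l0 expn0 => q1.
  have {}dichE : 4 * r0 <= 3 * 2 ^ d by case: dichE => //; lia.
  have -> : q = 1 by lia.
  by lia.
have := arith_cross j2 l0 sqp ql _ h hN.
rewrite -dE => /(_ dp') h2.
by rewrite expnS; lia.
Qed.

(** * Binary function spaces *)

Section BinarySpaces.
Local Open Scope ring_scope.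
Variables (R : realFieldType) (N : nat).
Implicit Types (f g h : 'rV[R]_N) (A b S T : {set 'I_N}) (V W : {vspace 'rV[R]_N}).

Definition ind S : 'rV[R]_N := \row_i (i \in S)%:R.

Definition supp f : {set 'I_N} := [set i | f 0 i != 0].

(** Restriction is followed by extension by zero, so that the spaces of all faces live in one
    ambient space. *)
Definition restr S : 'End('rV[R]_N) := linfun (mulmxr (diag_mx (ind S))).

Definition sets V : {set {set 'I_N}} := [set S | ind S \in V].

Definition supported A V := forall f, f \in V -> supp f \subset A.

(* V models the affine functions on the vertex set A of a 2-level polytope. The
   0/1-valued functions in V are identified with their supports: these are the
   complements of vertex sets of faces, and the minimal nonempty ones are the
   complements of facets. The last condition says that every proper face lies
   in a face of this kind. *)
Definition binary_space A V :=
  [/\ supported A V, ind A \in V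
    & forall f, f \in V -> f != 0 -> (forall i, 0 <= f 0 i) ->
      exists S, [/\ S \in sets V, S != set0 & S \subset supp f]].

Definition separated A V :=
  forall i j, i \in A -> j \in A ->
    (forall S, S \in sets V -> (i \in S) = (j \in S)) -> i = j.

Lemma indE S i : ind S 0 i = (i \in S)%:R.
Proof. by rewrite mxE. Qed.

Lemma restrE S f i : restr S f 0 i = (i \in S)%:R * f 0 i.
Proof. by rewrite lfunE /= mul_mx_diag !mxE mulrC. Qed.

Lemma supp_ind S : supp (ind S) = S.
Proof. by apply/setP => i; rewrite inE indE pnatr_eq0 eqb0 negbK. Qed.

Lemma ind_inj : injective ind.
Proof. by move=> S T e; rewrite -[S]supp_ind e supp_ind. Qed.

Lemma ind0 : ind set0 = 0.
Proof. by apply/rowP => i; rewrite indE inE mxE. Qed.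

Lemma supp0 f : (supp f == set0) = (f == 0).
Proof.
apply/eqP/eqP => [e|->]; last by apply/setP => i; rewrite !inE mxE eqxx.
apply/rowP => i; rewrite mxE; apply/eqP/negPn/negP => fi.
by have := in_set0 i; rewrite -e inE fi.
Qed.

Lemma supp_out f i : i \notin supp f -> f 0 i = 0.
Proof. by rewrite inE negbK => /eqP. Qed.

Lemma supp_subP f A : (forall i, i \notin A -> f 0 i = 0) -> supp f \subset A.
Proof.
move=> h; apply/subsetP => i; rewrite inE; apply: contraNT => /h ->.
by rewrite eqxx.
Qed.

Lemma supp_sub_out f A i : supp f \subset A -> i \notin A -> f 0 i = 0.
Proof. by move=> /subsetP fA; apply: contraNeq => fi; apply: fA; rewrite inE. Qed.

Lemma indD S T : [disjoint S & T] -> ind (S :|: T) = ind S + ind T.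
Proof.
move=> dST; apply/rowP => i; rewrite !mxE inE.
case iS: (i \in S); last by rewrite add0r.
by rewrite (disjointFr dST iS) addr0.
Qed.

Lemma indB S T : T \subset S -> ind (S :\: T) = ind S - ind T.
Proof.
move=> /subsetP sTS; apply/rowP => i; rewrite !mxE inE.
case iT: (i \in T); first by rewrite (sTS _ iT) subrr.
by rewrite subr0.
Qed.

Lemma restr_ind S T : restr S (ind T) = ind (T :&: S).
Proof.
by apply/rowP => i; rewrite restrE !indE inE -natrM mulnb andbC.
Qed.

Lemma restr_id S f : supp f \subset S -> restr S f = f.
Proof.
move=> fS; apply/rowP => i; rewrite restrE.
case: (boolP (i \in S)) => iS; first by rewrite mul1r.
by rewrite mul0r (supp_sub_out fS iS).
Qed.

Lemma supp_restr S f : supp (restr S f) = supp f :&: S.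
Proof.
apply/setP => i; rewrite !inE restrE mulf_eq0 negb_or pnatr_eq0 eqb0 negbK.
by rewrite andbC.
Qed.

Lemma restr_eq0 S f : (restr S f == 0) = [disjoint supp f & S].
Proof. by rewrite -supp0 supp_restr setI_eq0. Qed.

Lemma mem_sets V S : (S \in sets V) = (ind S \in V).
Proof. by rewrite inE. Qed.

Lemma sets0 V : set0 \in sets V.
Proof. by rewrite mem_sets ind0 mem0v. Qed.

Lemma sets_sub A V S : supported A V -> S \in sets V -> S \subset A.
Proof. by rewrite mem_sets => sV /sV; rewrite supp_ind. Qed.

Lemma setsD V S T : S \in sets V -> T \in sets V -> T \subset S ->
  S :\: T \in sets V.
Proof. by rewrite !mem_sets => SV TV sTS; rewrite indB// memvB. Qed.

Lemma setsU V S T : S \in sets V -> T \in sets V -> [disjoint S & T] ->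
  S :|: T \in sets V.
Proof. by rewrite !mem_sets => SV TV sTS; rewrite indD// memvD. Qed.

(* Subtract from f the largest multiple of ind S that keeps it nonnegative. *)
Lemma tilt f S : (forall i, 0 <= f 0 i) -> S != set0 -> S \subset supp f ->
  exists t, [/\ 0 < t, forall i, 0 <= (f - t *: ind S) 0 i
    & supp (f - t *: ind S) \proper supp f].
Proof.
move=> f0 /set0Pn[i0 i0S] sSf.
pose i1 := [arg min_(i < i0 in S) f 0 i]%O.
have [i1S i1min] : i1 \in S /\ forall i, i \in S -> f 0 i1 <= f 0 i.
  by rewrite /i1; case: Order.TotalTheory.arg_minP => // i iS imin; split.
have i1f := subsetP sSf _ i1S.
exists (f 0 i1); split.
- by rewrite lt_def f0 andbT; rewrite inE in i1f.
- move=> i; rewrite !mxE; case: (boolP (i \in S)) => iS.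
    by rewrite mulr1 subr_ge0 i1min.
  by rewrite mulr0 subr0.
- apply/properP; split; last first.
    by exists i1 => //; rewrite inE !mxE i1S mulr1 subrr eqxx.
  apply: supp_subP => i ni; rewrite !mxE (supp_out ni) sub0r.
  have /negbTE -> : i \notin S by apply: contra ni; apply: (subsetP sSf).
  by rewrite mulr0 oppr0.
Qed.

(** Iterating [tilt] splits off one set at a time while the support shrinks. *)
Lemma binary_cone A V f : binary_space A V -> f \in V ->
    (forall i, 0 <= f 0 i) ->
  exists2 t : {set 'I_N} -> R, (forall S, 0 <= t S)
    & f = \sum_(S in sets V) t S *: ind S.
Proof.
move=> [sV AV TV]; have [n] := ubnP #|supp f|; elim: n => // n IH in f *.
move=> ltn fV f0; have [->|fn0] := eqVneq f 0.
  by exists (fun=> 0) => //; rewrite big1// => S _; rewrite scale0r.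
have [S [SV S0 sSf]] := TV f fV fn0 f0.
have [t [t0 g0 pr]] := tilt f0 S0 sSf.
have [||//|u u0 gE] := IH (f - t *: ind S).
- by rewrite ltnS in ltn; apply: leq_trans ltn; apply: proper_card.
- by rewrite mem_sets in SV; rewrite memvB// memvZ.
exists (fun T => u T + (T == S)%:R * t).
  by move=> T; rewrite addr_ge0// mulr_ge0// ltW.
under eq_bigr do rewrite scalerDl.
rewrite big_split /= -gE (bigD1 S)//= eqxx mul1r big1 ?addr0 ?subrK//.
by move=> T /andP[_ /negbTE ->]; rewrite mul0r scale0r.
Qed.

(** A large multiple of [ind A] makes any function of V nonnegative, hence accessible to
    [binary_cone]. *)
Lemma binary_span A V : binary_space A V ->
  V = <<[seq ind T | T <- enum (sets V)]>>%VS.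
Proof.
move=> bV; have [sV AV _] := bV; apply/eqP; rewrite eqEsubv; apply/andP; split.
  apply/subvP => f fV; set X := (<<_>>)%VS.
  have indX S : S \in sets V -> ind S \in X.
    by move=> SV; apply: memv_span; apply: map_f; rewrite mem_enum.
  pose c := \sum_i `|f 0 i|.
  have gV : f + c *: ind A \in V by rewrite memvD// memvZ.
  have [|t _ gE] := binary_cone bV gV.
    move=> i; rewrite !mxE; case: (boolP (i \in A)) => iA.
      rewrite mulr1 /c (bigD1 i)//=; have := ler_norm (- f 0 i).
      have : 0 <= \sum_(j | j != i) `|f 0 j| by apply: sumr_ge0.
      by rewrite normrN; lra.
    by rewrite mulr0 addr0 (supp_sub_out (sV _ fV)).
  rewrite -[f](addrK (c *: ind A)) gE; apply: memvB; last first.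
    by apply: memvZ; apply: indX; rewrite mem_sets.
  by apply: memv_suml => T TV; apply: memvZ; apply: indX.
by apply/span_subvP => _ /mapP[S + ->]; rewrite mem_enum mem_sets.
Qed.

Lemma minimal_line A V b f : binary_space A V -> b \in sets V -> b != set0 ->
    (forall S, S \in sets V -> S != set0 -> S \subset b -> S = b) ->
    f \in V -> supp f \subset b -> exists t, f = t *: ind b.
Proof.
move=> [sV AV TV] bV /set0Pn[i0 i0b] bmin fV fb.
pose i1 := [arg max_(i > i0 in b) f 0 i]%O.
have [i1b i1max] : i1 \in b /\ forall i, i \in b -> f 0 i <= f 0 i1.
  by rewrite /i1; case: Order.TotalTheory.arg_maxP => // i iS imin; split.
(* g is nonnegative and its support is a proper subset of b, so it vanishes. *)
exists (f 0 i1); pose g := f 0 i1 *: ind b - f.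
have gE i : g 0 i = f 0 i1 * (i \in b)%:R - f 0 i by rewrite !mxE.
apply/eqP; rewrite eq_sym -subr_eq0 -/g; apply/negPn/negP => gn0.
have gb : supp g \subset b.
  by apply: supp_subP => i ib; rewrite gE (negbTE ib) (supp_sub_out fb ib) mulr0 subr0.
have [|//|i|S [SV S0 Sg]] := TV g.
- by rewrite memvB// memvZ// -mem_sets.
- rewrite gE; case: (boolP (i \in b)) => ib; first by rewrite mulr1 subr_ge0 i1max.
  by rewrite (supp_sub_out fb ib) mulr0 subr0.
- have Sb := bmin S SV S0 (subset_trans Sg gb).
  have : i1 \in supp g by apply: (subsetP Sg); rewrite Sb.
  by rewrite inE gE i1b mulr1 subrr eqxx.
Qed.

(** * Counting sets and points *)

Definition toggle n (i : 'I_n) (U : {set 'I_n}) :=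
  if i \in U then U :\ i else i |: U.

Lemma toggleK n (i : 'I_n) : involutive (toggle i).
Proof.
move=> U; rewrite /toggle; case: (boolP (i \in U)) => iU.
  by rewrite !inE eqxx /= setD1K.
by rewrite !inE eqxx /= setU1K.
Qed.

Lemma in_toggle n (i j : 'I_n) U : i != j -> (j \in toggle i U) = (j \in U).
Proof.
move=> ij; rewrite /toggle; case: ifP => _; rewrite !inE eq_sym (negbTE ij) //.
Qed.

Lemma sum_toggle n (al : 'I_n -> R) i U :
  \sum_(k in toggle i U) al k = \sum_(k in U) al k + (-1) ^+ (i \in U) * al i.
Proof.
rewrite /toggle; case: (boolP (i \in U)) => iU.
  by rewrite (big_setD1 i iU) /=; ring.
by rewrite big_setU1//=; ring.
Qed.

(** Nonzero x and y would each exchange 0 and 1, so that t + x = t + y and t + y + x = t, whence 2 x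
    = 0. *)
Lemma four_values (t x y : R) : x != 0 -> y != 0 ->
  ~~ [&& t \in [:: 0; 1], t + x \in [:: 0; 1], t + y \in [:: 0; 1]
       & t + y + x \in [:: 0; 1]].
Proof.
move=> x0 y0; apply/negP; rewrite !inE.
case/and4P => /orP[]/eqP h1 /orP[]/eqP h2 /orP[]/eqP h3 /orP[]/eqP h4;
  by move: x0 y0; rewrite !neq_lt => /orP[] ? /orP[] ?; lra.
Qed.

(* Of the four sets obtained from U by toggling i and j, at most three are in E. *)
Lemma card_two_coef n (E : {set {set 'I_n}}) (al : 'I_n -> R) i j :
    i != j -> al i != 0 -> al j != 0 ->
    (forall U, U \in E -> \sum_(k in U) al k \in [:: 0; 1]) ->
  (4 * #|E| <= 3 * 2 ^ n)%N.
Proof.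
move=> ij ai aj hE.
pose F (s : {set 'I_n} -> {set 'I_n}) := (\sum_U (s U \in E) : nat)%N.
have Finv s : injective s -> F s = #|E|.
  by move=> sI; rewrite /F -sum1_card [RHS]big_mkcond [RHS](reindex_inj sI).
have ti := inv_inj (toggleK i); have tj := inv_inj (toggleK j).
have : (F id + F (toggle i) + F (toggle j) + F (toggle i \o toggle j)
        <= \sum_(U : {set 'I_n}) 3)%N.
  rewrite /F -!big_split /=; apply: leq_sum => U _.
  have si : (-1) ^+ (i \in U) * al i != 0 by rewrite mulf_neq0// signr_eq0.
  have sj : (-1) ^+ (j \in U) * al j != 0 by rewrite mulf_neq0// signr_eq0.
  have := four_values (\sum_(k in U) al k) si sj.
  case h1: (U \in E); case h2: (toggle i U \in E); case h3: (toggle j U \in E);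
  case h4: (toggle i (toggle j U) \in E) => //.
  move: (hE _ h1) (hE _ h2) (hE _ h3) (hE _ h4).
  rewrite !sum_toggle in_toggle 1?eq_sym// => -> -> ->.
  by rewrite addrAC => ->.
rewrite !Finv//; last by apply: inj_comp.
rewrite sum_nat_const -cardsT -powersetT card_powerset cardsT card_ord; lia.
Qed.


(** Some [\dim V] columns of a basis matrix of V form an invertible block. [J] lists the
    corresponding points, and the rows of [K] are the basis of V dual to the evaluations at them. *)
Lemma eval_basis V : exists (J : 'I_(\dim V) -> 'I_N) (K : 'M[R]_(\dim V, N)),
  [/\ forall y : 'rV_(\dim V), y *m K \in V,
      forall f, f \in V -> f = (\row_j f 0 (J j)) *m K
    & forall (y : 'rV_(\dim V)) j, (y *m K) 0 (J j) = y 0 j].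
Proof.
pose M := \matrix_(k < \dim V) (vbasis V)`_k.
have ME (c : 'rV_(\dim V)) : c *m M = \sum_k c 0 k *: (vbasis V)`_k.
  by rewrite mulmx_sum_row; apply: eq_bigr => k _; rewrite rowK.
have Mfree : row_free M.
  apply: inj_row_free => c; rewrite ME => c0.
  have /freeP/(_ (fun k => c 0 k) c0) h := basis_free (vbasisP V).
  by apply/rowP => k; rewrite h mxE.
have Mfull : row_full M^T by rewrite /row_full mxrank_tr -/(row_free M).
pose J := fullrankfun Mfull; pose C := colsub J M.
have CT : C = (rowsub J M^T)^T by apply/matrixP => i j; rewrite !mxE.
have Cu : C \in unitmx by rewrite CT unitmx_tr fullrowsub_unit.
have cJ (c : 'rV_(\dim V)) : \row_j (c *m M) 0 (J j) = c *m C.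
  by apply/rowP => j; rewrite !mxE; apply: eq_bigr => k _; rewrite !mxE.
exists J, (invmx C *m M); split.
- move=> y; rewrite mulmxA ME; apply: memv_suml => k _; apply: memvZ.
  by apply: vbasis_mem; rewrite mem_nth// size_tuple.
- move=> f fV; have fE : f = (\row_k coord (vbasis V) k f) *m M.
    by rewrite ME {1}(coord_vbasis fV); apply: eq_bigr => k _; rewrite mxE.
  by rewrite [in RHS]fE cJ mulmxA mulmxK// -fE.
- move=> y j; have /rowP/(_ j) := cJ (y *m invmx C).
  by rewrite mulmxKV// mxE mulmxA.
Qed.

Lemma card_sets V : (#|sets V| <= 2 ^ \dim V)%N.
Proof.
have [J [K [_ KV _]]] := eval_basis V.
pose T (S : {set 'I_N}) := [set j | J j \in S].
rewrite -[X in (_ <= 2 ^ X)%N]card_ord -cardsT -card_powerset.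
rewrite -(@card_in_imset _ _ T).
  by apply: subset_leq_card; apply/subsetP => S _; rewrite inE subsetT.
move=> S S'; rewrite !mem_sets => SV SV' e; apply: ind_inj.
rewrite (KV _ SV) (KV _ SV'); congr (_ *m _).
apply/rowP => j; rewrite !mxE; have /setP/(_ j) := e.
by rewrite !inE => ->.
Qed.

(* Choose dim V points whose evaluations form a basis of the dual of V. If the
   evaluation at some other point has two nonzero coefficients, card_two_coef
   applies; otherwise every evaluation is one of the basis. *)
Lemma eval_dichotomy A V : supported A V -> ind A \in V ->
  (4 * #|sets V| <= 3 * 2 ^ \dim V)%N \/
  exists J : 'I_(\dim V) -> 'I_N,
    [/\ forall j, J j \in A,
        forall i, i \in A -> exists j, forall f, f \in V -> f 0 i = f 0 (J j)
      & forall j, exists2 f, f \in V & forall j', f 0 (J j') = (j == j')%:R].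
Proof.
move=> sV AV; have [J [K [KV VK KJ]]] := eval_basis V.
have deltaJ j j' : (delta_mx 0 j *m K : 'rV_N) 0 (J j') = (j == j')%:R.
  by rewrite KJ mxE eqxx eq_sym.
have JA j : J j \in A.
  apply: contraT => JjA; have := deltaJ j j; rewrite eqxx.
  by rewrite (supp_sub_out (sV _ (KV _)) JjA) => /eqP; rewrite eq_sym oner_eq0.
have fE f i : f \in V -> f 0 i = \sum_j f 0 (J j) * K j i.
  by move=> fV; rewrite {1}(VK f fV) mxE; apply: eq_bigr => j _; rewrite mxE.
case: (pickP [pred x : 'I_N * ('I_(\dim V) * 'I_(\dim V)) |
   [&& x.1 \in A, x.2.1 != x.2.2, K x.2.1 x.1 != 0 & K x.2.2 x.1 != 0]]).
  move=> [i [j j']] /= /and4P[iA jj' Kj Kj']; left.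
  pose T (S : {set 'I_N}) := [set k | J k \in S].
  have TI : {in sets V &, injective T}.
    move=> S S'; rewrite !mem_sets => SV SV' e; apply: ind_inj.
    rewrite (VK _ SV) (VK _ SV'); congr (_ *m _).
    apply/rowP => k; rewrite !mxE; have /setP/(_ k) := e.
    by rewrite !inE => ->.
  rewrite -(card_in_imset TI); apply: (card_two_coef (al := fun k => K k i) jj' Kj Kj').
  move=> _ /imsetP[S + ->]; rewrite mem_sets => SV.
  have -> : \sum_(k in T S) K k i = (i \in S)%:R; last first.
    by case: (i \in S); rewrite !inE eqxx ?orbT.
  rewrite -indE fE// [LHS]big_mkcond; apply: eq_bigr => k _.
  by rewrite inE indE; case: (J k \in S); rewrite ?mul1r ?mul0r.
move=> none; right; exists J; split => //; last first.
  by move=> j; exists (delta_mx 0 j *m K).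
(* [ind A] is 1 at all chosen points, so the coefficients at a point of [A] sum to 1; a single
   nonzero one must equal 1. *)
move=> i iA; have s1 : \sum_j K j i = 1.
  transitivity (ind A 0 i); last by rewrite indE iA.
  rewrite (fE _ i AV); apply: eq_bigr => j _.
  by rewrite indE JA mul1r.
have [j Kj] : exists j, K j i != 0.
  apply/existsP; apply: contraT => /existsPn h; move: s1; rewrite big1.
    by move=> /eqP; rewrite eq_sym oner_eq0.
  by move=> j _; apply/eqP; have := h j; rewrite negbK.
have K0 j' : j' != j -> K j' i = 0.
  move=> jj'; have := none (i, (j, j')); rewrite /= iA Kj eq_sym jj' /=.
  by move/negbT; rewrite negbK => /eqP.
exists j => f fV; rewrite (fE f i fV) (bigD1 j)//= big1 ?addr0; last first.
  by move=> j' jj'; rewrite K0// mulr0.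
have K1 : K j i = 1 by move: s1; rewrite (bigD1 j)//= big1 ?addr0.
by rewrite K1 mulr1.
Qed.

(** * Sets avoiding a point as 0/1 coordinates *)

Definition sets_off V a := [set S in sets V | a \notin S].

Lemma sets_off_double A V a : supported A V -> ind A \in V -> a \in A ->
  #|sets V| = (2 * #|sets_off V a|)%N.
Proof.
move=> sV AV aA; have AS : A \in sets V by rewrite mem_sets.
rewrite -(cardsID [set S : {set 'I_N} | a \notin S]) mul2n -addnn; congr addn.
  by apply: eq_card => S; rewrite !inE.
have DI : {in sets V &, injective (fun S => A :\: S)}.
  move=> S S' SV SV' e; rewrite -(setIidPr (sets_sub sV SV)) -(setIidPr (sets_sub sV SV')).
  by rewrite -[LHS]set0U -[RHS]set0U -(setDv A) -!setDDr e.
rewrite -(card_in_imset (f := fun S => A :\: S) (D := sets_off V a)); last first.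
  by move=> S S' /[!inE] /andP[h _] /andP[h' _]; apply: DI; rewrite inE.
apply: eq_card => S; apply/idP/imsetP.
  rewrite !inE negbK => /andP[aS SV]; exists (A :\: S).
    by rewrite inE setsD ?mem_sets//= ?inE ?aS// (sets_sub sV)// mem_sets.
  by rewrite setDDr setDv set0U (setIidPr _)// (sets_sub sV)// mem_sets.
case=> T; rewrite inE => /andP[TV aT] ->.
by rewrite inE [_ \in sets V]setsD ?(sets_sub sV)// !inE aA aT.
Qed.

Lemma free_subseq (vT : vectType R) (X : seq vT) : exists Y : seq vT,
  [/\ {subset Y <= X}, free Y & (<<X>> <= <<Y>>)%VS].
Proof.
elim: X => [|x X [Y [YX fY XY]]]; first by exists [::]; rewrite nil_free subvv.
case: (boolP (x \in <<Y>>%VS)) => xY; [exists Y | exists (x :: Y)]; split => //.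
- by move=> y /YX yX; rewrite inE yX orbT.
- by rewrite span_cons subv_add XY andbT -memvE.
- by move=> y; rewrite !inE => /orP[->//|/YX ->]; rewrite orbT.
- by rewrite free_cons xY.
- by rewrite !span_cons addvS.
Qed.

(** With a as the origin, the members of [Y] are 0/1-valued coordinates: they vanish at a, and
    together with [ind A] they form a basis of a binary space. *)
Lemma off_basis V a : exists Y : seq {set 'I_N},
  [/\ {subset Y <= sets_off V a}, free (map ind Y)
    & forall S, S \in sets_off V a -> ind S \in <<map ind Y>>%VS].
Proof.
have [Y [YX fY XY]] := free_subseq [seq ind T | T <- enum (sets_off V a)].
have [Z ZY YE] : exists2 Z : seq {set 'I_N}, {subset Z <= sets_off V a} &
    Y = map ind Z.
  elim: Y YX {fY XY} => [|y Y IH] YX; first by exists [::].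
  have [z zY|Z ZY ->] := IH; first by apply: YX; rewrite inE zY orbT.
  have /mapP[T] := YX y (mem_head _ _); rewrite mem_enum => Toff ->.
  by exists (T :: Z) => // z; rewrite inE => /orP[/eqP ->//|/ZY].
exists Z; split=> //; first by rewrite -YE.
move=> S Soff; rewrite -YE; apply: (subvP XY); apply: memv_span.
by apply: map_f; rewrite mem_enum.
Qed.

Section OffBasis.
Variables (A : {set 'I_N}) (V : {vspace 'rV[R]_N}) (a : 'I_N) (Y : seq {set 'I_N}).
Hypotheses (sV : supported A V) (AV : ind A \in V) (aA : a \in A).
Hypotheses (Yoff : {subset Y <= sets_off V a}) (fY : free (map ind Y))
  (Yspan : forall S, S \in sets_off V a -> ind S \in <<map ind Y>>%VS).

Lemma off_basis_free : free (ind A :: map ind Y).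
Proof.
rewrite free_cons fY andbT -[map _ _]in_tupleE; apply/negP => /coord_span AE.
have := indE A a; rewrite aA AE summxE big1.
  by move=> /eqP; rewrite eq_sym oner_eq0.
move=> i _; rewrite mxE; set y := _`_i.
have /mapP[T TY ->] : y \in map ind Y by apply: mem_nth; rewrite /=.
have := Yoff TY; rewrite inE => /andP[_ /negbTE aT].
by rewrite indE aT mulr0.
Qed.

Lemma off_basis_sub : (<<ind A :: map ind Y>> <= V)%VS.
Proof.
apply/span_subvP => f; rewrite inE => /orP[/eqP ->//|/mapP[T /Yoff + ->]].
by rewrite inE mem_sets => /andP[].
Qed.

Lemma off_basis_size : (size Y < \dim V)%N.
Proof.
have := dimvS off_basis_sub; move: off_basis_free; rewrite /free => /eqP ->.
by rewrite /= size_map.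
Qed.

Lemma off_basis_span : binary_space A V -> <<ind A :: map ind Y>>%VS = V.
Proof.
move=> bV; apply/eqP; rewrite eqEsubv off_basis_sub /= [X in (X <= _)%VS](binary_span bV).
have offI S : S \in sets_off V a -> ind S \in <<ind A :: map ind Y>>%VS.
  by move=> /Yspan; apply: subvP; rewrite span_cons addvSr.
apply/span_subvP => _ /mapP[T + ->]; rewrite mem_enum => TV.
case: (boolP (a \in T)) => aT; last by apply: offI; rewrite inE TV.
rewrite -[T](setIidPr (sets_sub sV TV)) -[_ :&: _]set0U -(setDv A) -setDDr.
rewrite indB ?subsetDl//; apply: memvB.
  by rewrite memv_span// mem_head.
by apply: offI; rewrite inE setsD ?(sets_sub sV)// ?mem_sets// !inE aT.
Qed.

Lemma off_basis_dim : binary_space A V -> \dim V = (size Y).+1.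
Proof.
move=> /off_basis_span <-; have := off_basis_free; rewrite /free => /eqP ->.
by rewrite /= size_map.
Qed.

(** The position of a point as a vertex of the 0/1 cube in the coordinates [Y]. *)
Let trace i := [set k : 'I_(size Y) | i \in nth set0 Y k].

Lemma off_coord S : S \in sets_off V a -> exists al : 'I_(size Y) -> R,
  forall i, (i \in S)%:R = \sum_(k in trace i) al k.
Proof.
move=> /Yspan e; have := @coord_span _ _ _ (map_tuple ind (in_tuple Y)) _ e.
move=> SE; exists (fun k => coord (map_tuple ind (in_tuple Y)) k (ind S)) => i.
rewrite -indE SE summxE [RHS]big_mkcond; apply: eq_bigr => k _.
rewrite mxE -SE (nth_map set0)// indE inE.
by case: (i \in nth set0 Y k); rewrite ?mulr1 ?mulr0.
Qed.

Hypothesis sepV : separated A V.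

Lemma trace_inj : {in A &, injective trace}.
Proof.
have offI i j S : trace i = trace j -> S \in sets_off V a -> (i \in S) = (j \in S).
  move=> e /off_coord[al alE]; have := alE i; rewrite e -alE => /eqP.
  by rewrite eqr_nat; case: (i \in S); case: (j \in S).
move=> i j iA jA e; apply: sepV => // S SV.
case: (boolP (a \in S)) => aS; last by apply: offI; rewrite // inE SV.
have Soff : A :\: S \in sets_off V a.
  by rewrite inE setsD ?(sets_sub sV)// ?mem_sets// !inE aS.
have := offI i j _ e Soff; rewrite !inE iA jA !andbT.
exact: negb_inj.
Qed.

Lemma card_points : (#|A| <= 2 ^ size Y)%N.
Proof.
rewrite -(card_in_imset trace_inj) -[X in (_ <= 2 ^ X)%N]card_ord -cardsT.
by rewrite -card_powerset subset_leq_card//; apply/subsetP => U _; rewrite inE subsetT.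
Qed.

(* The dual of eval_dichotomy: a set outside the basis Y has two nonzero
   coefficients in it. *)
Lemma points_dichotomy : (4 * #|A| <= 3 * 2 ^ size Y)%N \/
  forall S, S \in sets_off V a -> S = set0 \/ S \in Y.
Proof.
case: (boolP [forall S in sets_off V a, (S == set0) || (S \in Y)]).
  move=> /forall_inP h; right=> S /h /orP[/eqP|]; by [left | right].
rewrite negb_forall_in => /exists_inP[S Soff]; rewrite negb_or => /andP[S0 SY].
left; have [al alE] := off_coord Soff.
have [i0 i0S] := set0Pn _ S0.
have [k ak] : exists k, al k != 0.
  apply/existsP; apply: contraT => /existsPn h; have := alE i0.
  rewrite i0S big1 => [/eqP|k _]; first by rewrite oner_eq0.
  by apply/eqP; have := h k; rewrite negbK.
case: (pickP (fun k' => (k' != k) && (al k' != 0))) => [k' /andP[kk' ak']|none].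
  rewrite -(card_in_imset trace_inj); apply: (card_two_coef kk' ak' ak).
  move=> _ /imsetP[i _ ->]; rewrite -alE.
  by case: (i \in S); rewrite !inE eqxx ?orbT.
have SE i : (i \in S)%:R = (k \in trace i)%:R * al k.
  have al0 k' : k' != k -> al k' = 0.
    by move=> kk'; have := none k'; rewrite kk' /= => /negbT; rewrite negbK => /eqP.
  rewrite alE big_mkcond (bigD1 k)//= big1 ?addr0.
    by case: (k \in _); rewrite ?mul1r ?mul0r.
  by move=> k' /al0 ->; case: ifP.
have ak1 : al k = 1.
  have := SE i0; rewrite i0S; case: (k \in _); rewrite ?mul1r ?mul0r// => /eqP.
  by rewrite oner_eq0.
case/negP: SY; suff -> : S = nth set0 Y k by apply: mem_nth.
apply/setP => i; have := SE i; rewrite ak1 mulr1 inE => /eqP.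
by rewrite eqr_nat; by case: (i \in S); case: (i \in nth set0 Y k).
Qed.

End OffBasis.

Lemma card_points_dim A V : supported A V -> ind A \in V -> separated A V ->
  (2 * #|A| <= 2 ^ \dim V)%N.
Proof.
move=> sV AV sepV; have [->|/set0Pn[a aA]] := eqVneq A set0; first by rewrite cards0.
have [Y [Yoff fY Yspan]] := off_basis V a.
have h := card_points sV AV Yspan sepV.
have h2 := off_basis_size AV aA Yoff fY.
apply: leq_trans (leq_mul (leqnn 2) h) _.
by rewrite -expnS leq_exp2l.
Qed.

Lemma points_dichotomy_dim A V : binary_space A V -> separated A V ->
  (8 * #|A| <= 3 * 2 ^ \dim V)%N \/ (#|sets V| <= 2 * \dim V)%N.
Proof.
move=> bV sepV; have [sV AV _] := bV.
have [->|/set0Pn[a aA]] := eqVneq A set0; first by left; rewrite cards0.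
have [Y [Yoff fY Yspan]] := off_basis V a.
have dV := off_basis_dim sV AV aA Yoff fY Yspan bV.
have [h|h] := points_dichotomy sV AV Yspan sepV; [left|right].
  rewrite dV expnS; lia.
rewrite (sets_off_double sV AV aA) dV leq_mul2l /=.
apply: leq_trans (_ : #|mem (set0 :: Y)| <= _)%N; last exact: card_size.
by apply: subset_leq_card; apply/subsetP => S /h [->|SY]; rewrite inE ?eqxx// SY orbT.
Qed.

(** * Cutting along a largest facet *)

Lemma supported_span A V : supported A V ->
  (V <= <<[seq ind [set i] | i <- enum A]>>)%VS.
Proof.
move=> sV; apply/subvP => f fV.
have -> : f = \sum_(i in A) f 0 i *: ind [set i].
  apply/rowP => j; rewrite summxE; case: (boolP (j \in A)) => jA.
    rewrite (bigD1 j)//= big1 ?addr0 ?mxE ?inE ?eqxx ?mulr1//.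
    by move=> i /andP[_ ij]; rewrite !mxE inE eq_sym (negbTE ij) mulr0.
  rewrite (supp_sub_out (sV _ fV) jA) big1// => i iA.
  rewrite !mxE inE; case: eqP => [e|]; last by rewrite mulr0.
  by rewrite -e (negbTE jA) in iA.
apply: memv_suml => i iA; apply: memvZ; apply: memv_span.
by apply: map_f; rewrite mem_enum.
Qed.

Lemma supported_dim A V : supported A V -> (\dim V <= #|A|)%N.
Proof.
move=> /supported_span /dimvS /leq_trans; apply.
by apply: leq_trans (dim_span _) _; rewrite size_map -cardE.
Qed.

Lemma supported_full A V i : supported A V -> \dim V = #|A| -> i \in A ->
  ind [set i] \in V.
Proof.
move=> sV dV iA; have sVs := supported_span sV.
suff /eqP -> : V == <<[seq ind [set i] | i <- enum A]>>%VS.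
  by apply: memv_span; apply: map_f; rewrite mem_enum.
rewrite eqEdim sVs dV; apply: leq_trans (dim_span _) _.
by rewrite size_map -cardE.
Qed.

Lemma sets_restr V S T : S \in sets V -> S :&: T \in sets (restr T @: V)%VS.
Proof. by rewrite !mem_sets => SV; rewrite -restr_ind memv_img. Qed.

Lemma supported_restr V T : supported T (restr T @: V)%VS.
Proof. by move=> _ /memv_imgP[f fV ->]; rewrite supp_restr subsetIr. Qed.

Lemma separated_restr A V T : T \subset A -> separated A V ->
  separated T (restr T @: V)%VS.
Proof.
move=> /subsetP TA sepV i j iT jT h; apply: sepV; rewrite ?TA// => S SV.
by have := h _ (sets_restr T SV); rewrite !inE iT jT !andbT.
Qed.

Definition minimal_sets V := [set S in sets V | (S != set0) &&
  [forall T in sets V, (T != set0) && (T \subset S) ==> (T == S)]].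

Section Facet.
Variables (A b : {set 'I_N}) (V : {vspace 'rV[R]_N}).
Hypotheses (bV : binary_space A V) (bS : b \in sets V) (b0 : b != set0)
  (bmin : forall S, S \in sets V -> S != set0 -> (#|b| <= #|S|)%N).

(* A0 is the vertex set of a facet with the most vertices, V0 its space. The
   functions in VX vanish at the vertices b off the facet, and Vb restricts V to b. *)
Let A0 := A :\: b.
Let V0 := (restr A0 @: V)%VS.
Let VX := (V :&: lker (restr b))%VS.
Let Vb := (restr b @: V)%VS.

Let sV : supported A V. Proof. by case: bV. Qed.
Let AV : A \in sets V. Proof. by rewrite mem_sets; case: bV. Qed.
Let bA : b \subset A. Proof. exact: sets_sub bS. Qed.
Let A0V : A0 \in sets V. Proof. exact: setsD. Qed.

Lemma facet_minimal S : S \in sets V -> S != set0 -> S \subset b -> S = b.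
Proof. by move=> SV S0 Sb; apply/eqP; rewrite eqEcard Sb bmin. Qed.

Let line f : f \in V -> supp f \subset b -> exists t, f = t *: ind b.
Proof. exact: minimal_line bV bS b0 facet_minimal. Qed.

Let b_subC f : f \in V -> restr A0 f = 0 -> supp f \subset b.
Proof.
move=> fV /eqP; rewrite restr_eq0 => d; apply/subsetP => i iS.
have := sV fV => /subsetP/(_ i iS) iA.
by have := disjointFr d iS; rewrite inE iA andbT => /negbT; rewrite negbK.
Qed.

(** By [minimal_line], the kernel of restriction to [A0] is the line of [ind b]. *)
Lemma facet_dim : \dim V = (\dim V0).+1.
Proof.
rewrite -(limg_ker_dim (restr A0) V) -/V0 -[in RHS]add1n; congr addn.
have -> : (V :&: lker (restr A0))%VS = <[ind b]>%VS.
  apply/eqP; rewrite eqEsubv; apply/andP; split; apply/subvP => f.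
    rewrite memv_cap memv_ker => /andP[fV /eqP f0].
    have [t ->] := line fV (b_subC fV f0).
    by rewrite memvZ// memv_line.
  move=> /vlineP[t ->]; rewrite memvZ// memv_cap -mem_sets bS memv_ker.
  rewrite restr_ind; suff -> : b :&: A0 = set0 by rewrite ind0 eqxx.
  by rewrite setIDA setIC -setIDA setDv setI0.
by rewrite dim_vline -supp0 supp_ind b0.
Qed.

(* Extend f to A and subtract the largest multiple of ind b that keeps it
   nonnegative: the new zero on b excludes sets containing b. *)
Lemma facet_lift f : f \in V0 -> f != 0 -> (forall i, 0 <= f 0 i) ->
  exists S, [/\ S \in sets V, ~~ (b \subset S), ~~ (S \subset b)
    & S :&: A0 \subset supp f].
Proof.
move=> /memv_imgP[{}f fV ->] f0 fge.
have [i0 i0b] := set0Pn _ b0.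
pose i1 := [arg min_(i < i0 in b) f 0 i]%O.
have [i1b i1min] : i1 \in b /\ forall i, i \in b -> f 0 i1 <= f 0 i.
  by rewrite /i1; case: Order.TotalTheory.arg_minP => // i iS imin; split.
pose g := f - f 0 i1 *: ind b.
have gV : g \in V by rewrite memvB// memvZ// -mem_sets.
have gE i : g 0 i = f 0 i - f 0 i1 * (i \in b)%:R by rewrite !mxE.
have gA0 i : i \notin b -> g 0 i = f 0 i.
  by move=> /negbTE ib; rewrite gE ib mulr0 subr0.
have ggr : restr A0 g = restr A0 f.
  apply/rowP => i; rewrite !restrE; case: (boolP (i \in A0)); last by rewrite !mul0r.
  by rewrite inE => /andP[ib _]; rewrite gA0.
have [|i|S [SV S0 Sg]] := (let: And3 _ _ h := bV in h) g gV.
- by apply: contraNneq f0 => g0; rewrite -ggr g0 linear0.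
- case: (boolP (i \in b)) => ib; first by rewrite gE ib mulr1 subr_ge0 i1min.
  rewrite gA0//; case: (boolP (i \in A)) => iA; last by rewrite (supp_sub_out (sV fV)).
  by have := fge i; rewrite restrE inE ib iA mul1r.
have nbS : ~~ (b \subset S).
  apply/negP => /subsetP/(_ _ i1b)/(subsetP Sg).
  by rewrite inE gE i1b mulr1 subrr eqxx.
exists S; split => //; last by rewrite -ggr supp_restr setSI.
by apply: contra nbS => Sb; rewrite (facet_minimal SV S0 Sb).
Qed.

(** The set given by [facet_lift] is not contained in [b], so its trace on [A0] is nonempty. *)
Lemma facet_binary : binary_space A0 V0.
Proof.
split; first exact: supported_restr.
  by rewrite -mem_sets -[A0]setIid; apply: sets_restr.
move=> f fV f0 fge; have [S [SV nbS nSb Sf]] := facet_lift fV f0 fge.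
exists (S :&: A0); split => //; first exact: sets_restr.
apply: contra nSb => /eqP SA0; apply/subsetP => i iS; apply: contraT => ib.
by have := in_set0 i; rewrite -SA0 !inE iS ib (subsetP (sets_sub sV SV)).
Qed.

Lemma facet_separated : separated A V -> separated A0 V0.
Proof. exact/separated_restr/subsetDl. Qed.

Lemma facet_dimX : (\dim VX + \dim Vb)%N = \dim V.
Proof. exact: limg_ker_dim. Qed.

Lemma mem_VX f : (f \in VX) = (f \in V) && [disjoint supp f & b].
Proof. by rewrite memv_cap memv_ker restr_eq0. Qed.

Lemma sets_VX S : (S \in sets VX) = (S \in sets V) && [disjoint S & b].
Proof. by rewrite !mem_sets mem_VX supp_ind. Qed.

Lemma supported_VX : supported A0 VX.
Proof.
move=> f; rewrite mem_VX => /andP[/sV fA fb].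
by rewrite subsetD fA.
Qed.

Lemma ind_VX : ind A0 \in VX.
Proof. by rewrite -mem_sets sets_VX A0V -setI_eq0 setIC setIDA setIC -setIDA setDv setI0 eqxx. Qed.

Lemma VX_sub : (VX <= V0)%VS.
Proof.
apply/subvP => f fX; rewrite -(restr_id (supported_VX fX)).
by apply: memv_img; move: fX; rewrite mem_VX => /andP[].
Qed.

Lemma ind_Vb : ind b \in Vb.
Proof. by rewrite -mem_sets -[b]setIid sets_restr. Qed.

Lemma card_Vb : separated A V -> (2 * #|b| <= 2 ^ \dim Vb)%N.
Proof.
move=> sepV; apply: card_points_dim; first exact: supported_restr.
  exact: ind_Vb.
exact: separated_restr sepV.
Qed.

Definition non_super := [set S in sets V | ~~ (b \subset S)].

(** Removing [b] maps the sets that contain it bijectively onto those disjoint from it. *)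
Lemma sets_split : #|sets V| = (#|non_super| + #|sets VX|)%N.
Proof.
rewrite -(cardsID [set S : {set 'I_N} | b \subset S]) addnC; congr addn.
  by apply: eq_card => S; rewrite !inE andbC.
have UI : {in sets VX &, injective (fun S => S :|: b)}.
  move=> S T; rewrite !sets_VX => /andP[_ dS] /andP[_ dT] e.
  have h (U : {set _}) : [disjoint U & b] -> (U :|: b) :\: b = U.
    by move=> /setDidPl Ub; rewrite setDUl setDv setU0.
  by rewrite -(h _ dS) e h.
rewrite -(card_in_imset UI); apply: eq_card => S; rewrite in_setI inE.
apply/andP/imsetP => [[SV bS']|[T + ->]].
  exists (S :\: b); last by rewrite -{1}(setID S b) (setIidPr bS') setUC.
  rewrite sets_VX setsD//= -setI_eq0 setIC setIDA setIC -setIDA.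
  by rewrite setDv setI0.
by rewrite sets_VX => /andP[TV dT]; rewrite [_ \in sets V]setsU// subsetUr.
Qed.

(** Two sets with the same trace on [A0] differ by t times [ind b]. A point of [b] outside the one
    gives t <= 0, a point outside the other t >= 0. *)
Lemma non_super_le : (#|non_super| <= #|sets V0|)%N.
Proof.
have I : {in non_super &, injective (fun S => S :&: A0)}.
  move=> S T; rewrite !inE => /andP[SV bS'] /andP[TV bT] e.
  have [t tE] : exists t, ind S - ind T = t *: ind b.
    apply: line; first exact: memvB.
    by apply: b_subC; rewrite ?memvB// linearB /= !restr_ind e subrr.
  have /subsetPn[i1 i1b i1S] := bS'; have /subsetPn[i2 i2b i2T] := bT.
  have tt i : t * (i \in b)%:R = (i \in S)%:R - (i \in T)%:R.
    by have /rowP/(_ i) := tE; rewrite !mxE.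
  have t0 : t = 0.
    move: (tt i1) (tt i2); rewrite i1b i2b (negbTE i1S) (negbTE i2T).
    by case: (i1 \in T); case: (i2 \in S) => /=; lra.
  by apply: ind_inj; apply/eqP; rewrite -subr_eq0 tE t0 scale0r.
rewrite -(card_in_imset I); apply: subset_leq_card; apply/subsetP => _ /imsetP[S + ->].
by rewrite inE => /andP[SV _]; apply: sets_restr.
Qed.

Lemma facet_minimal_count : (#|minimal_sets V| <= #|non_super|)%N.
Proof.
set M := minimal_sets V.
(* Count b in place of set0, which is not minimal. *)
have bM S : S \in M -> b \subset S -> S = b.
  rewrite inE => /and3P[_ _ /forall_inP/(_ b bS)].
  by rewrite b0 /= => /implyP h /h /eqP.
have n0 : set0 \in non_super.
  by rewrite inE sets0 subset0.
have : (#|M :\ b| <= #|non_super :\ set0|)%N.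
  apply: subset_leq_card; apply/subsetP => S; rewrite in_setD1 => /andP[Sb SM].
  have nb : ~~ (b \subset S) by apply: contra Sb => /(bM _ SM) ->.
  by move: SM; rewrite in_setD1 inE => /and3P[SV -> _]; rewrite inE SV.
rewrite (cardsD1 set0 non_super) n0 (cardsD1 b M) => h.
by apply: leq_add h; exact: leq_b1.
Qed.

Lemma facet_half : (1 < \dim V)%N -> (#|b| <= #|A0|)%N.
Proof.
rewrite facet_dim ltnS => d0; apply: bmin => //.
apply: contraTneq d0 => A00; rewrite -leqNgt.
have := supported_dim (@supported_restr V A0).
by rewrite {2}A00 cards0.
Qed.

(** A third set S disjoint from [b] splits [A0] into two nonempty sets of V, each with at least as
    many points as [b]. *)
Lemma facet_third : (2 < #|sets VX|)%N -> (2 * #|b| <= #|A0|)%N.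
Proof.
move=> s2; have [S SX] : exists2 S, S \in sets VX & S \notin [set set0; A0].
  apply/subsetPn; apply: contraTN s2 => /subset_leq_card.
  by rewrite -leqNgt cards2; case: eqP => _ /= h; apply: leq_trans h _.
rewrite !inE negb_or => /andP[S0 SA0].
have SA : S \subset A0 by apply: sets_sub SX; apply: supported_VX.
have SV : S \in sets V by move: SX; rewrite sets_VX => /andP[].
rewrite -(cardsID S A0) (setIidPr SA) mul2n -addnn; apply: leq_add; apply: bmin => //.
  exact: setsD.
by rewrite setD_eq0; apply: contra SA0 => ?; rewrite eqEsubset SA.
Qed.

(** Fix a in [A0]. The sets avoiding a that lie in [V0] but not in [VX] span [V0] together with
    [VX], so passing to [VX] loses at least as many such sets as dimensions. *)
Lemma sets_VX_small : (#|sets V0| <= 2 * \dim V0)%N -> (1 < \dim V)%N ->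
  (#|sets VX| <= 2 * \dim VX)%N.
Proof.
move=> small dV; have [sV0 AV0 _] := facet_binary.
have [a aA0] : exists a, a \in A0.
  apply/set0Pn; rewrite -card_gt0; apply: leq_trans (facet_half dV).
  by rewrite card_gt0.
have c0 := sets_off_double sV0 AV0 aA0.
have cX := sets_off_double supported_VX ind_VX aA0.
pose D := sets_off V0 a :\: sets_off VX a.
have sub : sets_off VX a \subset sets_off V0 a.
  apply/subsetP => S; rewrite !inE => /andP[SX ->]; rewrite andbT.
  exact: (subvP VX_sub).
have span : (V0 <= VX + <<[seq ind T | T <- enum D]>>)%VS.
  rewrite [X in (X <= _)%VS](binary_span facet_binary).
  have offI S : S \in sets_off V0 a -> ind S \in (VX + <<[seq ind T | T <- enum D]>>)%VS.
    move=> So; case: (boolP (S \in sets_off VX a)) => SX.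
      by apply: (subvP (addvSl _ _)); move: SX; rewrite inE mem_sets => /andP[].
    apply: (subvP (addvSr _ _)); apply: memv_span; apply: map_f.
    by rewrite mem_enum inE SX.
  apply/span_subvP => _ /mapP[T + ->]; rewrite mem_enum => TV.
  case: (boolP (a \in T)) => aT; last by apply: offI; rewrite inE TV.
  have TA0 := sets_sub sV0 TV.
  rewrite -[T](setIidPr TA0) -[_ :&: _]set0U -(setDv A0) -setDDr.
  rewrite indB ?subsetDl//; apply: memvB.
    by apply: (subvP (addvSl _ _)); exact: ind_VX.
  by apply: offI; rewrite inE setsD// ?mem_sets// !inE aT.
have arith (d j n0 nX o0 oX r : nat) : (n0 <= 2 * d -> n0 = 2 * o0 ->
    nX = 2 * oX -> d <= j + r -> r <= o0 - oX -> oX <= o0 -> nX <= 2 * j)%N by clear; lia.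
apply: (arith _ _ _ _ _ _ _ small c0 cX); last exact: subset_leq_card sub.
  exact: leq_trans (dimvS span) (dimv_add_leqif _ _).1.
rewrite -[in X in (_ <= _ - X)%N](setIidPr sub) -cardsD.
by apply: leq_trans (dim_span _) _; rewrite size_map -cardE.
Qed.

Definition crossing := [set S in non_super | ~~ [disjoint S & b]].

(** These points can be added to or removed from any set of V. In a polytope they are apexes of
    pyramids over the face of all other vertices. *)
Definition free_points := [set v in A0 | [set v] \in sets V].

Lemma non_super_split : #|non_super| = (#|crossing| + #|sets VX|)%N.
Proof.
rewrite -(cardsID [set S : {set 'I_N} | ~~ [disjoint S & b]]); congr addn.
  by apply: eq_card => S; rewrite !inE.
apply: eq_card => S; rewrite sets_VX !inE negbK.
case: (boolP [disjoint S & b]) => /= dS; last by rewrite andbF.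
suff -> : ~~ (b \subset S) by rewrite andbT.
  by apply: contra b0 => bS'; rewrite -(setIidPr bS') setI_eq0.
Qed.

Lemma sets_free (U : {set 'I_N}) : U \subset free_points -> U \in sets V.
Proof.
move=> /subsetP UM; rewrite mem_sets.
have -> : ind U = \sum_(v in U) ind [set v].
  apply/rowP => i; rewrite summxE indE; case: (boolP (i \in U)) => iU.
    rewrite (bigD1 i)//= big1 ?addr0 ?indE ?inE ?eqxx//.
    by move=> v /andP[_ vi]; rewrite indE inE eq_sym (negbTE vi).
  rewrite big1// => v vU; rewrite indE inE; case: eqP => // e.
  by rewrite e vU in iU.
by apply: memv_suml => v /UM; rewrite !inE => /andP[].
Qed.

(* A crossing set stays crossing when its trace on free_points is changed. *)
Lemma crossing_lower : (2 ^ #|free_points| * (2 * (\dim Vb).-1) <= #|crossing|)%N.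
Proof.
pose C := [set S :&: b | S in crossing].
have le1 : (2 ^ #|free_points| * #|C| <= #|crossing|)%N.
  rewrite -card_powerset mulnC -cardsX.
  pose F (S : {set 'I_N}) := (S :&: b, S :&: free_points).
  apply: leq_trans (_ : #|F @: crossing| <= _)%N; last exact: leq_imset_card.
  apply: subset_leq_card; apply/subsetP => -[X U] /setXP[/imsetP[S + ->]].
  rewrite !inE => /andP[/andP[SV nbS] ndS] UM.
  have Mb : [disjoint free_points & b].
    rewrite -setI_eq0 -subset0; apply/subsetP => v.
    by rewrite !inE => /andP[/andP[/andP[/negbTE ->]]].
  pose SM := S :\: free_points.
  have SMV : SM \in sets V.
    have -> : SM = S :\: (S :&: free_points) by rewrite setDIr setDv set0U.
    by rewrite setsD ?subsetIl ?mem_sets// -mem_sets sets_free ?subsetIr.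
  have dSU : [disjoint SM & U].
    rewrite -setI_eq0 -subset0; apply/subsetP => v; rewrite in_setI in_setD.
    by case/andP=> /andP[/negP vM _] /(subsetP UM).
  have bM i : i \in b -> i \in free_points = false by move=> ib; rewrite (disjointFl Mb ib).
  have Ub : (SM :|: U) :&: b = S :&: b.
    apply/setP => i; rewrite !in_setI in_setU in_setD; case: (boolP (i \in b)) => ib.
      rewrite (bM _ ib) /=; have := contra (subsetP UM i) (negbT (bM _ ib)).
      by move=> /negbTE ->; rewrite orbF.
    by rewrite !andbF.
  apply/imsetP; exists (SM :|: U).
    rewrite /crossing /non_super !in_set -!mem_sets (setsU SMV (sets_free UM) dSU) /=.
    have := congr1 (fun X : {set 'I_N} => b \subset X) Ub.
    by rewrite !subsetI subxx !andbT -setI_eq0 Ub setI_eq0 ndS => ->; rewrite nbS.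
  rewrite /F /= Ub; congr (_, _); apply/setP => i; rewrite in_setI in_setU in_setD.
  case: (boolP (i \in free_points)) => iM; first by rewrite andbT.
  by rewrite andbF; apply/negbTE; apply: contra iM; apply: (subsetP UM).
apply: leq_trans le1; rewrite leq_mul2l; apply/orP; right.
(* The traces of crossing sets on [b] come in complementary pairs. Those avoiding a span [Vb]
   together with [ind b], so there are at least [(\dim Vb).-1] of them. *)
have [a ab] := set0Pn _ b0.
pose C0 := [set X in C | a \notin X]; pose C1 := (fun X => b :\: X) @: C0.
have CC X : X \in C -> b :\: X \in C.
  case/imsetP => S + ->; rewrite !in_set -!mem_sets => /andP[/andP[SV nbS] ndS].
  apply/imsetP; exists (A :\: S).
    rewrite !in_set -!mem_sets setsD ?(sets_sub sV)//=; apply/andP; split.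
      apply: contra ndS => /subsetP h; rewrite -setI_eq0 -subset0.
      by apply/subsetP => i; rewrite !inE => /andP[iS /h]; rewrite inE iS.
    apply: contra nbS => dd; apply/subsetP => i ib; have := disjointFl dd ib.
    by rewrite inE (subsetP bA _ ib) andbT => /negbT; rewrite negbK.
  apply/setP => i; rewrite !inE; case: (boolP (i \in b)) => ib; rewrite ?andbF//=.
  by rewrite !andbT (subsetP bA _ ib) andbT.
have card2 : (2 * #|C0| <= #|C|)%N.
  have <- : #|C0 :|: C1| = (2 * #|C0|)%N.
    rewrite cardsU (_ : C0 :&: C1 = set0) ?cards0 ?subn0; last first.
      apply/eqP; rewrite -subset0; apply/subsetP => X; rewrite inE => /andP[].
      rewrite inE => /andP[_ aX] /imsetP[Y + XE].
      by rewrite inE => /andP[_ aY]; move: aX; rewrite XE inE aY ab.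
    rewrite card_in_imset ?mul2n ?addnn// => X Y.
    have h Z : Z \in C0 -> b :\: (b :\: Z) = Z.
      rewrite inE => /andP[/imsetP[S _ ->] _].
      by rewrite setDDr setDv set0U setIC -setIA setIid.
    by move=> XC YC e; rewrite -(h _ XC) e h.
  apply: subset_leq_card; apply/subsetP => X; rewrite inE => /orP[].
    by rewrite inE => /andP[].
  by case/imsetP => Y; rewrite inE => /andP[/CC ? _] ->.
apply: leq_trans card2; rewrite leq_mul2l /= -subn1 leq_subLR add1n.
have -> : Vb = <<[seq ind (T :&: b) | T <- enum (sets V)]>>%VS.
  rewrite /Vb {1}(binary_span bV) limg_span -map_comp; congr <<_>>%VS.
  by apply: eq_map => T /=; rewrite restr_ind.
apply: (@leq_trans (\dim <<ind b :: [seq ind X | X <- enum C0]>>)); last first.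
  by apply: leq_trans (dim_span _) _; rewrite /= size_map -cardE.
apply: dimvS; apply/span_subvP => _ /mapP[T + ->]; rewrite mem_enum => TV.
set W := <<_>>%VS.
have bW : ind b \in W by rewrite memv_span// mem_head.
have C0W X : X \in C0 -> ind X \in W.
  by move=> XC; rewrite memv_span// inE map_f ?orbT// mem_enum.
case: (boolP [disjoint T & b]) => dT.
  by move: dT; rewrite -setI_eq0 => /eqP ->; rewrite ind0 mem0v.
case: (boolP (b \subset T)) => bT; first by rewrite (setIidPr bT).
have TC : T :&: b \in C.
  by apply: imset_f; rewrite !in_set -!mem_sets TV bT.
case: (boolP (a \in T :&: b)) => aT; last by apply: C0W; rewrite in_set TC.
rewrite -[T :&: b](setIidPr (subsetIr T b)) -[_ :&: (_ :&: _)]set0U -(setDv b) -setDDr.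
rewrite indB ?subsetDl// memvB// C0W// in_set CC//=.
by rewrite in_setD ab andbT aT.
Qed.

(* In the second case of eval_dichotomy for VX, the points of A0 fall into dim VX
   layers whose indicators are in V; a layer with one point is a free point. *)
Lemma layers : (4 * #|sets VX| <= 3 * 2 ^ \dim VX)%N \/
  (2 * \dim VX <= #|A0| + #|free_points|)%N.
Proof.
have [|[J [JA0 cover delta]]] := eval_dichotomy supported_VX ind_VX; [by left|right].
have [g gX gJ] := fin_all_exists2 delta.
pose L j := [set i in A0 | g j 0 i == 1].
have gL i j0 : i \in A0 -> (forall f, f \in VX -> f 0 i = f 0 (J j0)) ->
    forall j, g j 0 i = (j == j0)%:R.
  by move=> iA h j; rewrite h// gJ.
have LE i j0 : i \in A0 -> (forall f, f \in VX -> f 0 i = f 0 (J j0)) ->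
    forall j, (i \in L j) = (j == j0).
  move=> iA h j; rewrite inE iA (gL _ _ iA h) /=.
  by case: (j == j0); rewrite ?eqxx// eq_sym oner_eq0.
have LV j : L j \in sets V.
  have : L j \in sets VX.
    rewrite mem_sets (_ : ind (L j) = g j)//; apply/rowP => i; rewrite indE.
    case: (boolP (i \in A0)) => iA; last first.
      by rewrite inE (negbTE iA) (supp_sub_out (supported_VX (gX j)) iA).
    by have [j0 h] := cover i iA; rewrite (LE _ _ iA h) (gL _ _ iA h).
  by rewrite sets_VX => /andP[].
have JL j : J j \in L j by rewrite inE JA0 gJ eqxx /= eqxx.
have sumL : (\sum_j #|L j| <= #|A0|)%N.
  rewrite -[#|A0|]sum1_card.
  under eq_bigr => j _ do rewrite -sum1_card big_mkcond /=.
  rewrite exchange_big [leqRHS]big_mkcond; apply: leq_sum => i _ /=.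
  case: (boolP (i \in A0)) => iA.
    have [j0 h] := cover i iA; rewrite (bigD1 j0)//= (LE _ _ iA h) eqxx.
    by rewrite big1// => j /negbTE jj0; rewrite (LE _ _ iA h) jj0.
  by rewrite big1// => j _; rewrite inE (negbTE iA).
have J_inj : injective J.
  by move=> j j' e; apply/eqP; rewrite -(LE (J j') j' (JA0 j'))// -e.
have sumK : (\sum_j (#|L j| == 1%N) <= #|free_points|)%N.
  apply: leq_trans (_ : #|J @: [set j | #|L j| == 1%N]| <= _)%N.
    rewrite card_imset// -sum1_card [leqRHS]big_mkcond /=.
    by apply: leq_sum => j _; rewrite inE; case: (_ == _).
  apply: subset_leq_card; apply/subsetP => _ /imsetP[j + ->].
  rewrite inE => /cards1P[v Lv]; rewrite in_set JA0.
  by have := JL j; have := LV j; rewrite Lv in_set1 => ? /eqP ->.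
(* Every layer contributes at least 2: two points, or one point counted again as a free point. *)
apply: leq_trans (leq_add sumL sumK); rewrite -big_split /=.
rewrite mulnC -[in leqLHS](card_ord (\dim VX)) -sum_nat_const; apply: leq_sum => j _.
have : (0 < #|L j|)%N by apply/card_gt0P; exists (J j).
by case: #|L j| => [|[|]].
Qed.

End Facet.

(** * The product bounds *)

Lemma exists_facet A V : binary_space A V -> A != set0 ->
  exists b, [/\ b \in sets V, b != set0
    & forall S, S \in sets V -> S != set0 -> (#|b| <= #|S|)%N].
Proof.
move=> [_ AV _] A0.
pose P S := (S \in sets V) && (S != set0).
have PA : P A by rewrite /P mem_sets AV A0.
case: (arg_minnP (fun S : {set 'I_N} => #|S|) PA) => b /andP[bV b0] bmin.
by exists b; split => // S SV S0; apply: bmin; rewrite /P SV.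
Qed.

Lemma sets_excess A V : binary_space A V -> separated A V ->
  (\dim V < #|A|)%N -> (4 * #|sets V| <= 3 * 2 ^ \dim V)%N.
Proof.
move=> [sV AV _] sepV lt; have [//|[J [JA cover _]]] := eval_dichotomy sV AV.
move: lt; rewrite ltnNge => /negP[].
apply: leq_trans (_ : #|J @: setT| <= _)%N; last first.
  by apply: leq_trans (leq_imset_card _ _) _; rewrite cardsT card_ord.
apply: subset_leq_card; apply/subsetP => i iA; have [j h] := cover i iA.
apply/imsetP; exists j => //; apply: sepV => // S; rewrite mem_sets => SV.
by have /eqP := h _ SV; rewrite !indE eqr_nat; case: (i \in S); case: (_ \in S).
Qed.

(** Complementation makes the number of sets even. *)
Lemma sets_parity A V n : binary_space A V -> A != set0 ->
  (#|sets V| <= 2 * n)%N \/ (2 * n.+1 <= #|sets V|)%N.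
Proof.
move=> [sV AV _] /set0Pn[a aA]; rewrite (sets_off_double sV AV aA) !leq_mul2l /=.
by case: (leqP _ n); [left|right].
Qed.

(** The hypotheses exclude the simplex and the cube, whose product (d + 1) 2^(d+1), with d =
    [\dim V] - 1, exceeds the bound for d >= 3. *)
Lemma product_bound A V : binary_space A V -> separated A V ->
  (\dim V < #|A|)%N -> (2 * (\dim V).+1 <= #|sets V|)%N ->
  (#|A| * #|sets V| <= (\dim V).-1 * 2 ^ \dim V + 4 * (\dim V).-1)%N.
Proof.
have [d] := ubnP (\dim V); elim: d => // d IH in A V *.
rewrite ltnS => leVd bV sepV ltA ltB; have [sV AV _] := bV.
have cA := card_points_dim sV AV sepV.
have [d' dV] : exists d', \dim V = d'.+2.
  by case: (\dim V) cA ltA => [|[|d']]; [lia|rewrite expn1; lia|exists d'].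
have A0 : A != set0 by rewrite -card_gt0; lia.
have [b [bS b0 bmin]] := exists_facet bV A0.
have fd := facet_dim bV bS b0 bmin.
have bV0 := facet_binary bV bS b0 bmin.
have sepV0 : separated (A :\: b) (restr (A :\: b) @: V).
  exact: facet_separated.
have half : (#|b| <= #|A :\: b|)%N by apply: (facet_half bV bS b0 bmin); rewrite dV.
have [sV0 AV0 _] := bV0.
have b1 : (0 < #|b|)%N by rewrite card_gt0.
have A00 : A :\: b != set0 by rewrite -card_gt0 (leq_trans b1).
have dV0 : \dim (restr (A :\: b) @: V) = d'.+1 by apply: succn_inj; rewrite -fd dV.
have dXb := facet_dimX b V.
have bA := sets_sub sV bS.
have AE : #|A| = (#|A :\: b| + #|b|)%N.
  by rewrite -(cardsID b A) (setIidPr bA) addnC.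
rewrite AE (sets_split bS) dV /=.
apply: (@arith_product d'.+1 _ _ _ _ #|sets (restr (A :\: b) @: V)|
  (\dim (V :&: lker (restr b))) (\dim (restr b @: V)) #|free_points A b V| #|crossing b V|) => //.
- by rewrite -AE; move: ltA; rewrite dV; lia.
- by rewrite -(sets_split bS); move: ltB; rewrite dV; lia.
- by rewrite -dV0; apply: supported_dim.
- exact: (non_super_le bV bS b0 bmin).
- by rewrite -dV0; apply: card_sets.
- by rewrite -dV0; apply: card_points_dim.
- exact: (facet_third bV bS bmin).
- exact: (card_Vb bV bS).
- by rewrite dXb dV.
- exact: card_sets.
- exact: (non_super_split V b0).
- exact: (crossing_lower bV bS b0).
- have := points_dichotomy_dim bV0 sepV0; rewrite dV0; by [].
- have [h|h] := leqP #|A :\: b| d'.+1; [by right | left].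
  by rewrite -dV0; apply: (sets_excess bV0 sepV0); rewrite dV0.
- exact: (layers bV bS).
- by rewrite -dV0; move=> h; apply: (sets_VX_small bV bS b0 bmin) => //; rewrite dV.
- exact: sets_parity bV0 A00.
- rewrite -dV0 => h1 h2; apply: IH => //; rewrite dV0; lia.
Qed.

(** * Recognising the cube and the cross-polytope *)

Definition affine_coordinates A V d (psi : 'I_d -> 'rV[R]_N) :=
  (forall k, psi k \in V) /\
  (V <= <<ind A :: [seq psi k | k <- enum 'I_d]>>)%VS.

Definition cube_like A V d := exists Y : 'I_d -> {set 'I_N},
  affine_coordinates A V (fun k => ind (Y k)) /\
  forall U : {set 'I_d}, exists2 i, i \in A & forall k, (i \in Y k) = (k \in U).

Definition cross_like A V d := exists psi : 'I_d -> 'rV[R]_N,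
  [/\ affine_coordinates A V psi,
      forall i, i \in A -> exists k (e : bool),
        forall k', psi k' 0 i = (-1) ^+ e * (k == k')%:R
    & forall k (e : bool), exists2 i, i \in A &
        forall k', psi k' 0 i = (-1) ^+ e * (k == k')%:R].

(** By counting, the sets avoiding a are the empty set and the d members of the basis. If a vertex
    of the cube in these coordinates were missing, the function cutting it off would be nonnegative
    on [A] without being a conic combination of sets, against [binary_cone]. *)
Lemma cube_case A V d : binary_space A V -> A != set0 -> \dim V = d.+1 ->
  (#|sets V| <= 2 * d.+1)%N -> cube_like A V d.
Proof.
move=> bV /set0Pn[a aA] dV small; have [sV AV _] := bV.
have [Y [Yoff fY Yspan]] := off_basis V a.
have sY : size Y = d.
  by apply: succn_inj; rewrite -(off_basis_dim sV AV aA Yoff fY Yspan bV).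
have spanV := off_basis_span sV AV Yoff Yspan bV.
have fX := off_basis_free aA Yoff fY.
have offY S : S \in sets_off V a -> S = set0 \/ S \in Y.
  have uY : uniq (set0 :: Y).
    rewrite /= (map_uniq (free_uniq fY)) andbT; apply/negP => Y0.
    have := free_not0 fY (map_f ind Y0); rewrite ind0 eqxx//.
  have sub : {subset set0 :: Y <= enum (sets_off V a)}.
    move=> T; rewrite mem_enum inE => /orP[/eqP ->|/Yoff//].
    by rewrite inE sets0 inE.
  have := sets_off_double sV AV aA => c2.
  have le : (size (enum (sets_off V a)) <= size (set0 :: Y))%N.
    by rewrite -cardE /= sY -(@leq_pmul2l 2)// -c2.
  have [_ eqS] := uniq_min_size uY sub le.
  move=> So; have : S \in set0 :: Y by rewrite eqS mem_enum.
  by rewrite inE => /orP[/eqP|]; [left|right].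
pose y (k : 'I_d) := nth set0 Y k.
have yY k : y k \in Y by apply: mem_nth; rewrite sY.
have yV k : ind (y k) \in V by have := Yoff _ (yY k); rewrite inE mem_sets => /andP[].
exists y; split.
  split=> //; rewrite -[X in (X <= _)%VS]spanV; apply: sub_span => f.
  rewrite !inE => /orP[->//|/mapP[T TY ->]]; apply/orP; right.
  have iT : (index T Y < d)%N by rewrite -sY index_mem.
  apply/mapP; exists (Ordinal iT); first by rewrite mem_enum.
  by rewrite /y /= nth_index.
move=> U; case: (boolP [exists i in A, [forall k, (i \in y k) == (k \in U)]]).
  by move=> /exists_inP[i iA /forallP h]; exists i => // k; apply/eqP.
rewrite negb_exists_in => /forall_inP none; exfalso.
have sX : size (map ind Y) == d by rewrite size_map sY.
pose X : d.+1.-tuple 'rV[R]_N := [tuple of ind A :: Tuple sX].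
(* lam evaluates functions at the missing vertex U of the cube. It is nonnegative
   on sets V, hence on the nonnegative functions of V, but lam f = -1. *)
pose lam f := coord X ord0 f + \sum_(k in U) coord X (lift ord0 k) f.
have lamD f g : lam (f + g) = lam f + lam g.
  rewrite /lam linearD /=; under eq_bigr do rewrite linearD /=.
  by rewrite big_split /= addrACA.
have lamZ c f : lam (c *: f) = c * lam f.
  rewrite /lam linearZ /=; under eq_bigr do rewrite linearZ /=.
  by rewrite -mulr_sumr mulrDr.
have lam0 : lam 0 = 0 by rewrite -(scale0r 0) lamZ mul0r.
have X0 : X`_(ord0 : 'I_d.+1) = ind A by [].
have XS k : X`_(lift ord0 k) = ind (y k) by rewrite lift0 /= (nth_map set0) ?sY.
have lamA : lam (ind A) = 1.
  rewrite /lam -X0 coord_free// eqxx big1 ?addr0// => k _.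
  by rewrite coord_free.
have lamy k : lam (ind (y k)) = (k \in U)%:R.
  rewrite /lam -XS coord_free// add0r.
  under eq_bigr do rewrite coord_free// (inj_eq lift_inj).
  case: (boolP (k \in U)) => kU.
    by rewrite (bigD1 k)//= eqxx big1 ?addr0// => j /andP[_ jk]; rewrite eq_sym (negbTE jk).
  by rewrite big1// => j jU; case: eqP => // e; rewrite e jU in kU.
have lamoff S : S \in sets_off V a -> 0 <= lam (ind S) <= 1.
  move=> /offY[->|SY]; first by rewrite ind0 lam0 lexx ler01.
  have iS : (index S Y < d)%N by rewrite -sY index_mem.
  have -> : S = y (Ordinal iS) by rewrite /y /= nth_index.
  by rewrite lamy; case: (_ \in U); rewrite ?lexx ?ler01.
have lamS S : S \in sets V -> 0 <= lam (ind S).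
  move=> SV; case: (boolP (a \in S)) => aS; last first.
    by have /lamoff/andP[] : S \in sets_off V a by rewrite inE SV.
  have /lamoff/andP[_] : A :\: S \in sets_off V a.
    by rewrite inE setsD ?(sets_sub sV)// ?mem_sets// !inE aS.
  by rewrite indB ?(sets_sub sV)// lamD -scaleN1r lamZ lamA mulN1r lerBlDr lerDl.
(* On [A], [f] is one less than the number of coordinates in which a point differs from [U]. *)
pose f := \sum_k ((k \in U)%:R *: ind A + (-1) ^+ (k \in U) *: ind (y k)) - ind A.
have fV : f \in V.
  by rewrite memvB// memv_suml// => k _; rewrite memvD// memvZ.
have f0 i : 0 <= f 0 i.
  case: (boolP (i \in A)) => iA; last by rewrite (supp_sub_out (sV _ fV)).
  rewrite mxE summxE !mxE iA.
  have [k kU] : exists k, (i \in y k) != (k \in U).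
    by have := none i iA; rewrite negb_forall => /existsP.
  have tE j : ((j \in U)%:R *: ind A + (-1) ^+ (j \in U) *: ind (y j)) 0 i =
      ((i \in y j) != (j \in U))%:R.
    by rewrite !mxE iA; case: (j \in U); case: (i \in y j) => /=; lra.
  rewrite (bigD1 k)//= tE kU.
  under eq_bigr do rewrite tE.
  by rewrite addrAC subrr add0r sumr_ge0.
have [t t0 fE] := binary_cone bV fV f0.
have : 0 <= lam f.
  rewrite fE (big_morph lam lamD lam0) sumr_ge0// => S SV.
  by rewrite lamZ mulr_ge0// lamS.
rewrite /f lamD -scaleN1r lamZ lamA (big_morph lam lamD lam0) big1; first by lra.
move=> k _; rewrite lamD !lamZ lamA lamy.
by case: (k \in U) => /=; lra.
Qed.

(** The facet [A0] is a simplex with vertices [v k]. Each [ind [set v k]] lifts to a set [S k]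
    missing exactly one point of [b], the antipode of [v k]; the coordinate [psi k] is 1 at [v k],
    -1 at the antipode and 0 at the other points. *)
Lemma cross_case A b V d : binary_space A V -> b \in sets V -> b != set0 ->
    (forall S, S \in sets V -> S != set0 -> (#|b| <= #|S|)%N) ->
    \dim V = d.+1 -> #|A :\: b| = d -> (3 < d)%N -> (d.-1 <= #|b|)%N ->
  cross_like A V d.
Proof.
move=> bV bS b0 bmin dV pd d3 dq; have [sV AV _] := bV.
have fd := facet_dim bV bS b0 bmin; have bV0 := facet_binary bV bS b0 bmin.
have [sV0 AV0 _] := bV0; set A0 := A :\: b in pd fd bV0 sV0 AV0.
set V0 := (_ @: V)%VS in fd bV0 sV0 AV0.
have bA := sets_sub sV bS.
have dV0 : \dim V0 = #|A0| by apply: succn_inj; rewrite -fd dV pd.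
(* The lifted set has at least as many points as [b] and only one outside [b], so it misses at most
   one point of [b]. *)
have ex v : v \in A0 -> exists S, [/\ S \in sets V, S :&: A0 = [set v] & #|b :\: S| = 1%N].
  move=> vA0; have vV0 := supported_full sV0 dV0 vA0.
  have [||S [SV nbS nSb]] := facet_lift bV bS b0 bmin vV0.
  - by rewrite -supp0 supp_ind -card_gt0 cards1.
  - by move=> i; rewrite indE ler0n.
  rewrite supp_ind -/A0 => Sv.
  have SA0 : S :&: A0 = [set v].
    apply/eqP; rewrite eqEcard Sv cards1 card_gt0.
    apply: contra nSb => /eqP SA0; apply/subsetP => i iS; apply: contraT => ib.
    by have := in_set0 i; rewrite -SA0 !inE iS ib (subsetP (sets_sub sV SV)).
  exists S; split => //; apply/eqP; rewrite eqn_leq; apply/andP; split; last first.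
    by rewrite card_gt0 setD_eq0.
  have S0 : S != set0 by apply: contra nSb => /eqP ->; rewrite sub0set.
  have le1 : (#|S :\: A0| <= #|b :&: S|)%N.
    apply: subset_leq_card; apply/subsetP => i; rewrite !inE.
    move=> /andP[h iS]; rewrite iS andbT; move: h.
    by rewrite (subsetP (sets_sub sV SV) _ iS) andbT negbK.
  have := bmin S SV S0; rewrite -(cardsID S b) -(cardsID A0 S) SA0 cards1 addnC => le2.
  by rewrite -(leq_add2r #|b :&: S|) (leq_trans le2)// leq_add2l.
pose v (k : 'I_d) : 'I_N := enum_val (cast_ord (esym pd) k).
have vA0 k : v k \in A0 by apply: enum_valP.
have v_inj : injective v by move=> j k /enum_val_inj/cast_ord_inj.
have v_surj i : i \in A0 -> exists k, i = v k.
  move=> iA0; exists (cast_ord pd (enum_rank_in iA0 i)).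
  by rewrite /v cast_ordK enum_rankK_in.
have [S hS] := fin_all_exists (fun k => ex (v k) (vA0 k)).
have SV k : ind (S k) \in V by have [] := hS k; rewrite mem_sets.
have Sv k i : i \in A0 -> (i \in S k) = (i == v k).
  by move=> iA0; have [_ /setP/(_ i) + _] := hS k; rewrite in_setI in_set1 iA0 andbT.
have vb k : v k \in b = false by have := vA0 k; rewrite inE => /andP[/negbTE].
have vA k : v k \in A by have := vA0 k; rewrite inE => /andP[].
have line f : f \in V -> (forall k, f 0 (v k) = 0) -> exists t, f = t *: ind b.
  move=> fV f0; apply: (minimal_line bV bS b0 (facet_minimal bmin)) => //.
  apply: supp_subP => i ib; case: (boolP (i \in A)) => iA; last first.
    exact: supp_sub_out (sV _ fV) iA.
  by have [|k ->] := v_surj i; [rewrite inE ib|].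
(* Hence all points of b lie outside the same number c of sets S k, and double
   counting gives |b| c = d, so c = 1. *)
have [t tE] : exists t, \sum_k ind (S k) - ind A = t *: ind b.
  apply: line; first by rewrite memvB// memv_suml.
  move=> k; rewrite mxE summxE !mxE vA (bigD1 k)//= big1 ?addr0; last first.
    by move=> j jk; rewrite indE Sv// (inj_eq v_inj) eq_sym (negbTE jk).
  by rewrite indE Sv// eqxx subrr.
have cnt w : w \in b -> (\sum_k (w \in S k))%:R = t + 1 :> R.
  move=> wb; have /rowP/(_ w) := tE; rewrite !mxE summxE wb (subsetP bA _ wb) mulr1.
  move=> <-; rewrite subrK natr_sum; apply: eq_bigr => k _.
  by rewrite indE.
have [w0 w0b] := set0Pn _ b0.
pose c := (\sum_k (w0 \notin S k))%N.
have comp w : (\sum_k (w \in S k) + \sum_k (w \notin S k) = d)%N.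
  rewrite -big_split /= (eq_bigr (fun=> 1%N)); last by move=> k _; case: (w \in S k).
  by rewrite sum_nat_const card_ord muln1.
have cE w : w \in b -> (\sum_k (w \notin S k) = c)%N.
  move=> wb; have : (\sum_k (w \in S k))%N = (\sum_k (w0 \in S k))%N.
    by apply/eqP; rewrite -(eqr_nat R) !cnt.
  by have := comp w; have := comp w0; rewrite /c; lia.
have dc : (#|b| * c = d)%N.
  rewrite -sum_nat_const -(eq_bigr _ cE) exchange_big /=.
  rewrite -[RHS]card_ord -sum1_card; apply: eq_bigr => k _.
  have [_ _ <-] := hS k; rewrite -sum1_card [RHS]big_mkcond [LHS]big_mkcond.
  by apply: eq_bigr => w _; rewrite inE; case: (w \in b); case: (w \in S k).
(* c >= 2 would give 2 (d - 1) <= d. *)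
have c1 : c = 1%N.
  by case: (c) dc => [|[|c']]; rewrite ?muln0 ?muln1; nia.
pose psi k := ind (S k) - ind b.
have psiV k : psi k \in V by rewrite memvB// -mem_sets.
have psiv k k' : psi k' 0 (v k) = (k == k')%:R.
  by rewrite !mxE vb subr0 Sv// (inj_eq v_inj).
have psib w k : w \in b -> psi k 0 w = - (w \notin S k)%:R.
  by move=> wb; rewrite !mxE wb; case: (w \in S k) => /=; lra.
have wk w : w \in b -> exists k, forall k', (w \notin S k') = (k == k').
  move=> wb; have /eqP := cE _ wb; rewrite c1 => /eqP s1.
  have [k wk] : exists k, w \notin S k.
    apply/existsP; apply: contraT => /existsPn h; move: s1; rewrite big1// => k _.
    by apply/eqP; rewrite eqb0 h.
  exists k => k'; case: eqP => [<-//|/eqP kk']; apply/negbTE/negP => wk'.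
  by move: s1; rewrite (bigD1 k)//= (bigD1 k') 1?eq_sym//= wk wk'.
have kw k : exists2 w, w \in b & forall k', (w \notin S k') = (k == k').
  have [_ _ /eqP/cards1P[w bw]] := hS k.
  have : w \in b :\: S k by rewrite bw set11.
  rewrite inE => /andP[wS wb]; exists w => // k'.
  have [k0 h] := wk w wb; rewrite h; have := h k; rewrite wS => /esym/eqP <-.
  by [].
exists psi; split.
- split=> //; apply/subvP => f fV; set W := <<_>>%VS.
  have AW : ind A \in W by rewrite memv_span// mem_head.
  have psiW k : psi k \in W.
    by rewrite memv_span// inE map_f ?orbT// mem_enum.
  have dec g : g \in V -> exists t, g = \sum_k g 0 (v k) *: psi k + t *: ind b.
    move=> gV; have [|k|s sE] := line (g - \sum_k g 0 (v k) *: psi k).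
    - by rewrite memvB// memv_suml// => k _; rewrite memvZ.
    - rewrite mxE mxE summxE (bigD1 k)//= big1; last first.
        by move=> j /negbTE jk; rewrite mxE psiv eq_sym jk mulr0.
      by rewrite mxE psiv eqxx mulr1 addr0 subrr.
    by exists s; rewrite -sE addrC subrK.
  (* For [ind A], the coefficient of [ind b] in [dec] is 2: at [w0] one [psi k] is -1 and the others
     vanish. *)
  have bW : ind b \in W.
    have [s sE] := dec _ AV; have s2 : s = 2.
      have [k h] := wk _ w0b; have /rowP/(_ w0) := sE.
      rewrite !mxE summxE (subsetP bA _ w0b) w0b mulr1.
      rewrite (bigD1 k)//= big1 ?addr0; last first.
        by move=> j jk; rewrite mxE psib// h eq_sym (negbTE jk) oppr0 mulr0.
      by rewrite mxE psib// h eqxx indE vA /=; lra.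
    have -> : ind b = 2^-1 *: (ind A - \sum_k ind A 0 (v k) *: psi k).
      by rewrite {1}sE s2 addrAC subrr add0r scalerA mulVf ?scale1r// pnatr_eq0.
    by rewrite memvZ// memvB// memv_suml// => k _; rewrite memvZ.
  have [s ->] := dec f fV.
  by rewrite memvD ?memvZ// memv_suml// => k _; rewrite memvZ.
- move=> i iA; case: (boolP (i \in b)) => ib.
    have [k h] := wk i ib; exists k, true => k'.
    by rewrite psib// h expr1 mulN1r.
  have [|k ->] := v_surj i; first by rewrite inE ib.
  by exists k, false => k'; rewrite psiv expr0 mul1r.
- move=> k [].
    have [w wb h] := kw k; exists w; first exact: (subsetP bA).
    by move=> k'; rewrite psib// h expr1 mulN1r.
  by exists (v k) => // k'; rewrite psiv expr0 mul1r.
Qed.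

Lemma facet_product A V d : binary_space A V -> separated A V ->
    \dim V = d.+1 -> (1 < d)%N ->
  [\/ (#|A| * #|minimal_sets V| <= (d - 1) * 2 ^ (d + 1) + 8 * (d - 1))%N,
      cube_like A V d | cross_like A V d].
Proof.
move=> bV sepV dV d1; have [sV AV _] := bV.
have A0 : A != set0.
  by rewrite -card_gt0; apply: leq_trans (supported_dim sV); rewrite dV.
have [b [bS b0 bmin]] := exists_facet bV A0.
have fd := facet_dim bV bS b0 bmin; have bV0 := facet_binary bV bS b0 bmin.
have sepV0 := facet_separated (b := b) sepV.
have half : (#|b| <= #|A :\: b|)%N by apply: (facet_half bV bS b0 bmin); rewrite dV ltnW.
have third := facet_third bV bS bmin.
have cM : (#|minimal_sets V| <= #|non_super b V|)%N by apply: facet_minimal_count.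
have r0 := non_super_le bV bS b0 bmin.
have [sV0 AV0 _] := bV0.
have b1 : (0 < #|b|)%N by rewrite card_gt0.
have A00 : A :\: b != set0 by rewrite -card_gt0 (leq_trans b1).
have AE : #|A| = (#|A :\: b| + #|b|)%N.
  by rewrite -(cardsID b A) (setIidPr (sets_sub sV bS)) addnC.
have dV0 : \dim (restr (A :\: b) @: V) = d by apply: succn_inj; rewrite -fd dV.
have B0 := card_sets (restr (A :\: b) @: V)%VS.
have P0 := card_points_dim sV0 AV0 sepV0.
have dp := supported_dim sV0.
have ss := sets_split bS.
have cube := cube_case bV A0 dV.
have cross := cross_case bV bS b0 bmin dV.
have par := sets_parity d bV0 A00.
have prod := product_bound bV0 sepV0.
rewrite dV0 in B0 P0 dp prod; rewrite {bmin fd bV bV0 sV0 AV0 sepV0 sepV A00 A0}.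
move: third half cM r0 b1 AE B0 P0 dp ss cube cross par prod.
rewrite addn1 expnS.
move: (#|A|) (#|A :\: b|) (#|b|) (#|minimal_sets V|) (#|non_super b V|)
  (#|sets (restr (A :\: b) @: V)|) (#|sets V|) (#|sets (_ :&: _)%VS|) => nA p q M r n0 nB s.
move=> third half cM r0 b1 -> B0 P0 dp ss cube cross par prod.
(* For d = 2 and d = 3 the product 2 d 2^d of the cube and of the cross-polytope equals the
   bound. *)
have small : (d <= 3)%N -> ((p + q) * M <= 2 * d * 2 ^ d)%N ->
    ((p + q) * M <= (d - 1) * (2 * 2 ^ d) + 8 * (d - 1))%N.
  by case: (d) d1 => [|[|[|[|]]]].
(* A simplex facet: p + q <= 2 (d - 1) unless q >= d - 1, which means the cross-polytope if d >
   3. *)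
have [pd|pd] := leqP p d.
  have pE : p = d by lia.
  have [q1|q1] := ltnP q d.-1.
    constructor 1; have : ((p + q) * M <= (2 * (d - 1)) * 2 ^ d)%N by apply: leq_mul; lia.
    lia.
  have [d3|d3] := ltnP 3 d; first by constructor 3; apply: cross.
  by constructor 1; apply: small => //; apply: leq_mul; lia.
case: par => n0d; last first.
  constructor 1; have := prod pd n0d.
  have : ((p + q) * M <= (2 * p) * n0)%N by apply: leq_mul; lia.
  rewrite !subn1; lia.
have [s2|s2] := leqP s 2; first by constructor 2; apply: cube; lia.
(* Here p <= 2^(d-1) and 2 q <= p give p + q <= 3/4 2^d, against at most 2 d facets. *)
have {}third := third s2; constructor 1.
have [d3|d3] := leqP d 3.
  apply: small => //; have : ((p + q) * M <= 2 ^ d * (2 * d))%N by apply: leq_mul; lia.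
  lia.
have : (4 * (p + q) * M <= (3 * 2 ^ d) * (2 * d))%N by apply: leq_mul; lia.
have : (6 * d * 2 ^ d <= 8 * (d - 1) * 2 ^ d)%N by rewrite leq_mul2r; apply/orP; right; lia.
lia.
Qed.

End BinarySpaces.

From mathcomp Require Import finmap boolp classical_sets functions cardinality reals.

(** * Convex hulls *)

Section Convexity.
Local Open Scope classical_set_scope.
Local Open Scope ring_scope.
Context {R : realType}.

Section Dot.
Context {n : nat}.
Implicit Types (c x y : 'rV[R]_n).

Lemma dotDl c c' x : dot (c + c') x = dot c x + dot c' x.
Proof. by rewrite /dot -big_split; apply: eq_bigr => i _; rewrite mxE mulrDl. Qed.

Lemma dotZl t c x : dot (t *: c) x = t * dot c x.
Proof. by rewrite /dot mulr_sumr; apply: eq_bigr => i _; rewrite mxE mulrA. Qed.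

Lemma dotNl c x : dot (- c) x = - dot c x.
Proof. by rewrite -scaleN1r dotZl mulN1r. Qed.

Lemma dotDr c x y : dot c (x + y) = dot c x + dot c y.
Proof. by rewrite /dot -big_split; apply: eq_bigr => i _; rewrite mxE mulrDr. Qed.

Lemma dotZr t c x : dot c (t *: x) = t * dot c x.
Proof. by rewrite /dot mulr_sumr; apply: eq_bigr => i _; rewrite mxE mulrCA. Qed.

Lemma dotNr c x : dot c (- x) = - dot c x.
Proof. by rewrite -scaleN1r dotZr mulN1r. Qed.

Lemma dot0l x : dot 0 x = 0.
Proof. by rewrite /dot big1// => i _; rewrite mxE mul0r. Qed.

Lemma dot_delta j x : dot (delta_mx 0 j) x = x 0 j.
Proof.
rewrite /dot (bigD1 j)//= big1 ?addr0 ?mxE ?eqxx ?mul1r//.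
by move=> i /negbTE ij; rewrite mxE ij mul0r.
Qed.

Lemma dot_self_gt0 x : x != 0 -> 0 < dot x x.
Proof.
move=> x0; rewrite lt_def sumr_ge0 ?andbT; last by move=> i _; rewrite -expr2 sqr_ge0.
apply: contra x0; rewrite psumr_eq0; last by move=> i _; rewrite -expr2 sqr_ge0.
move=> /allP h; apply/eqP/rowP => i; have /eqP := h i (mem_index_enum _).
by rewrite mxE => /eqP; rewrite mulf_eq0 orbb => /eqP.
Qed.

End Dot.

(* Induction on m: if the functional found for the first m vectors is negative on
   the last one, project along the last vector onto the kernel of the functional. *)
Lemma farkas n m (w : 'I_m -> 'rV[R]_n) (v : 'rV[R]_n) :
  (exists2 l : 'I_m -> R, (forall i, 0 <= l i) & v = \sum_i l i *: w i) \/
  (exists2 c, (forall i, 0 <= dot c (w i)) & dot c v < 0).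
Proof.
elim: m => [|m IH] in w v *.
  have [->|v0] := eqVneq v 0; [left|right].
    by exists (fun=> 0); rewrite ?big_ord0// => -[].
  by exists (- v); [case | rewrite dotNl oppr_lt0 dot_self_gt0].
have [[l l0 vE]|[c cw cv]] := IH (fun i => w (lift ord0 i)) v.
  left; exists (fun i => if unlift ord0 i is Some j then l j else 0).
    by move=> i; case: unliftP.
  rewrite big_ord_recl unlift_none scale0r add0r vE.
  by apply: eq_bigr => i _; rewrite liftK.
set w0 := w ord0; have [cw0|cw0] := leP 0 (dot c w0).
  by right; exists c => // i; case: (unliftP ord0 i) => [j ->|->].
pose pr (x : 'rV[R]_n) := x - (dot c x / dot c w0) *: w0.
have [[l l0 vE]|[c' c'w c'v]] := IH (fun i => pr (w (lift ord0 i))) (pr v).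
  left; pose t := dot c v / dot c w0 - \sum_i l i * (dot c (w (lift ord0 i)) / dot c w0).
  exists (fun i => if unlift ord0 i is Some j then l j else t).
    move=> i; case: unliftP => // _.
    rewrite /t subr_ge0 (@le_trans _ _ 0)//.
      apply: sumr_le0 => j _; rewrite mulr_ge0_le0// mulr_ge0_le0//.
      by rewrite invr_le0 ltW.
    by rewrite mulr_le0// ?invr_le0 ltW.
  rewrite big_ord_recl unlift_none.
  under eq_bigr do rewrite liftK.
  move/eqP: vE; rewrite subr_eq => /eqP ->.
  under [in LHS]eq_bigr do rewrite /pr scalerBr scalerA.
  by rewrite sumrB -scaler_suml /t scalerBl [RHS]addrC addrA [RHS]addrAC.
right; pose k := dot c' w0 / dot c w0.
have prE x : dot (c' - k *: c) x = dot c' (pr x).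
  rewrite dotDl dotDr dotNl dotNr dotZl dotZr; congr (_ - _).
  by rewrite /k mulrAC [RHS]mulrAC [dot c' w0 * _]mulrC.
exists (c' - k *: c); last by rewrite prE.
move=> i; rewrite prE; case: (unliftP ord0 i) => [j ->//|->].
by rewrite /pr -/w0 divff ?lt_eqF// scale1r subrr /dot big1// => j _; rewrite mxE mulr0.
Qed.

(** Farkas' lemma for the points lifted to height 1 in one more dimension: the height turns conic
    into convex combinations, and its coefficient in the functional becomes [be]. *)
Lemma hull_separation n (s : seq 'rV[R]_n) (v : 'rV[R]_n) :
  convex_hull [set` s] v \/
  exists c be, (forall x, x \in s -> 0 <= dot c x + be) /\ dot c v + be < 0.
Proof.
pose up (x : 'rV[R]_n) : 'rV[R]_(n + 1) := row_mx x (const_mx 1).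
pose w (i : 'I_(size s)) := tnth (in_tuple s) i.
have dot_up c x : dot c (up x) = dot (lsubmx c) x + c 0 (rshift n ord0).
  rewrite /dot big_split_ord big_ord1 /= row_mxEr mxE mulr1; congr (_ + _).
  by apply: eq_bigr => i _; rewrite row_mxEl mxE.
have [[l l0 vE]|[c cw cv]] := farkas (fun i => up (w i)) (up v); [left|right].
  exists (size s), l, w; split => //.
  - by move=> i; apply: mem_tnth.
  - have := congr1 (fun y : 'rV_(n + 1) => y 0 (rshift n ord0)) vE.
    rewrite row_mxEr mxE summxE => ->; apply: eq_bigr => i _.
    by rewrite mxE row_mxEr mxE mulr1.
  - apply/rowP => j; have := congr1 (fun y : 'rV_(n + 1) => y 0 (lshift 1 j)) vE.
    rewrite row_mxEl => ->; rewrite !summxE; apply: eq_bigr => i _.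
    by rewrite mxE row_mxEl mxE.
exists (lsubmx c), (c 0 (rshift n ord0)); split; last by rewrite -dot_up.
move=> x xs; rewrite -dot_up; have /tnthP[i ->] : x \in in_tuple s by [].
exact: cw.
Qed.

Lemma hull_affine_ge0 n (A : set 'rV[R]_n) c be x :
  (forall y, A y -> 0 <= dot c y + be) -> convex_hull A x -> 0 <= dot c x + be.
Proof.
move=> h [k [w [y [Ay w0 w1 ->]]]]; rewrite dot_sum -[be]mul1r -w1 mulr_suml -big_split /=.
by apply: sumr_ge0 => i _; rewrite -mulrDr mulr_ge0// h.
Qed.

Lemma hull1 n (v : 'rV[R]_n) : convex_hull [set v] = [set v].
Proof.
apply/seteqP; split => [x [k [w [y [yv _ w1 ->]]]]|x ->]; last exact: sub_convex_hull.
rewrite /= -[RHS]scale1r -w1 scaler_suml.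
by apply: eq_bigr => i _; rewrite (yv i).
Qed.

Lemma hull_nonempty n (A : set 'rV[R]_n) x : convex_hull A x -> A !=set0.
Proof.
move=> [[|k] [w [y [Ay w0 w1 _]]]]; last by exists (y ord0).
by move: w1; rewrite big_ord0 => /eqP; rewrite eq_sym oner_eq0.
Qed.

Lemma irredundant_hull n (s : seq 'rV[R]_n) : exists2 t : seq 'rV[R]_n,
  convex_hull [set` t] = convex_hull [set` s]
  & forall x, x \in t -> ~ convex_hull [set` [seq y <- t | y != x]] x.
Proof.
have [k] := ubnP (size s); elim: k => // k IH in s *; rewrite ltnS => sk.
have [[x [xs hx]]|none] := pselect (exists x, x \in s /\
    convex_hull [set` [seq y <- s | y != x]] x); last first.
  by exists s => // x xs hx; apply: none; exists x.
have [|t tE ht] := IH [seq y <- s | y != x].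
  apply: leq_trans sk; rewrite size_filter -(count_predC (fun y => y != x)).
  rewrite -addn1 leq_add2l -has_count; apply/hasP; exists x => //=.
  by rewrite eqxx.
exists t => //; rewrite {}tE; apply/seteqP; split.
  by apply: convex_hull_mono => y /=; rewrite mem_filter => /andP[].
(* A functional nonnegative on the other points is nonnegative at x, hence on the whole hull, so
   nothing separates y from the smaller hull. *)
move=> y hy; have [//|[c [be [h1 h2]]]] := hull_separation [seq y <- s | y != x] y.
exfalso; move: h2; rewrite ltNge => /negP; apply.
apply: hull_affine_ge0 hy => z /= zs; have [->|zx] := eqVneq z x.
  by apply: hull_affine_ge0 hx => u /=; apply: h1.
by apply: h1; rewrite mem_filter zx.
Qed.

(** In an irredundant list of generators, the functional separating a point from the hull of the
    others exposes that point as a vertex. *)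
Lemma polytope_vertices n (P : set 'rV[R]_n) : polytope P ->
  P = convex_hull (vertices P).
Proof.
move=> [V /finite_seqP[s0 ->] ->]; have [s <- irr] := irredundant_hull s0.
set P' := convex_hull _; suff -> : vertices P' = [set` s] by [].
apply/seteqP; split => v /=.
  move=> /face_convex_hull vE; have : convex_hull ([set` s] `&` [set v]) v by rewrite -vE.
  by move=> /hull_nonempty[x [xs /= <-]].
move=> vs; have [//|[c [be [cs cv]]]] := hull_separation [seq y <- s | y != v] v.
  by move=> /(irr _ vs).
have cmin x : x \in s -> dot (- c) x <= dot (- c) v /\ (dot (- c) x = dot (- c) v -> x = v).
  move=> xs; have [->//|xv] := eqVneq x v.
  have := cs x; rewrite mem_filter xv => /(_ xs) cx.
  by rewrite !dotNl; split; [lra | move=> e; exfalso; lra].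
have vface : face P' (P' `&` [set x | dot (- c) x = dot (- c) v]).
  exists (- c), (dot (- c) v); split => // x hx.
  have : 0 <= dot c x - dot c v.
    by apply: hull_affine_ge0 hx => y /cmin[+ _]; rewrite !dotNl; lra.
  by rewrite !dotNl; lra.
rewrite /vertices /=; suff <- : P' `&` [set x | dot (- c) x = dot (- c) v] = [set v] by [].
rewrite (face_convex_hull vface) -[RHS]hull1; congr convex_hull.
apply/seteqP; split => x /=; first by move=> [/cmin[_ h] [_ /h]].
by move=> ->; split => //; split => //; apply: sub_convex_hull.
Qed.

End Convexity.

(** * Affine functions on the vertices of a 2-level polytope *)

Section Points.
Local Open Scope ring_scope.
Context {R : realType} {n N : nat}.
Variable (a : 'I_N -> 'rV[R]_n).
Implicit Types (Z S T : {set 'I_N}) (f g : 'rV[R]_N) (c : 'rV[R]_n).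
Local Notation ind := (@ind R N).

Let full : {set 'I_N} := [set: 'I_N]%SET.

Definition hull Z : set 'rV[R]_n := convex_hull (a @` [set` Z])%classic.

Definition values : 'M[R]_(n, N) := \matrix_(j, i) a i 0 j.

Definition aff_space : {vspace 'rV[R]_N} :=
  (<[ind full]> + limg (linfun (mulmxr values)))%VS.

Lemma memv_limg_mulmxr m p (B : 'M[R]_(m, p)) (f : 'rV[R]_p) :
  (f \in limg (linfun (mulmxr B) : 'Hom('rV[R]_m, 'rV[R]_p))) = (f <= B)%MS.
Proof.
apply/memv_imgP/submxP => [[c _ ->]|[c ->]]; first by exists c; rewrite lfunE.
by exists c; [rewrite memvf | rewrite lfunE].
Qed.

Lemma dim_limg_mulmxr m p (B : 'M[R]_(m, p)) :
  \dim (limg (linfun (mulmxr B) : 'Hom('rV[R]_m, 'rV[R]_p))) = \rank B.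
Proof.
have -> : limg (linfun (mulmxr B) : 'Hom('rV[R]_m, 'rV[R]_p)) =
    limg (linfun (mulmxr (row_base B)) : 'Hom('rV[R]__, 'rV[R]_p)).
  by apply/vspaceP => f; rewrite !memv_limg_mulmxr eq_row_base.
rewrite limg_dim_eq ?dimvf ?/dim /= ?mul1n//.
apply/eqP; rewrite -subv0; apply/subvP => u; rewrite memv_cap memv_ker lfunE /=.
rewrite memv0 => /andP[_ /eqP u0].
by apply/eqP; apply: (row_free_inj (row_base_free B)); rewrite u0 mul0mx.
Qed.

Lemma mul_values c i : (c *m values) 0 i = dot c (a i).
Proof. by rewrite mxE; apply: eq_bigr => j _; rewrite mxE. Qed.

Lemma aff_spaceP f :
  f \in aff_space <-> exists c be, forall i, f 0 i = dot c (a i) + be.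
Proof.
split=> [/memv_addP[_ /vlineP[be ->] [g]]|[c [be fE]]].
  rewrite memv_limg_mulmxr => /submxP[c ->] ->; exists c, be => i.
  by rewrite !mxE inE mulr1 addrC -mul_values mxE.
have -> : f = be *: ind full + c *m values.
  by apply/rowP => i; rewrite fE mxE mul_values !mxE inE mulr1 addrC.
by rewrite memv_add// ?memvZ ?memv_line// memv_limg_mulmxr submxMl.
Qed.

Lemma ind_full : ind full \in aff_space.
Proof. by apply/aff_spaceP; exists 0, 1 => i; rewrite indE inE dot0l add0r. Qed.

(** Rows outside Z are zero, so the row space is the direction space of the affine hull of the
    points in Z. *)
Definition differences Z i1 : 'M[R]_(N, n) := \matrix_i ((i \in Z)%:R *: (a i - a i1)).

Definition directions Z i1 : {vspace 'rV[R]_n} :=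
  limg (linfun (mulmxr (differences Z i1))).

(** Up to constants, the affine functions on Z form the row space of the transposed matrix of
    differences, and transposition preserves the rank; the constants add 1. *)
Lemma dim_restr Z i1 : i1 \in Z ->
  \dim (restr R Z @: aff_space) = (\dim (directions Z i1)).+1.
Proof.
move=> i1Z; pose G := limg (linfun (mulmxr (differences Z i1)^T) : 'Hom('rV[R]_n, 'rV[R]_N)).
have GE c i : (c *m (differences Z i1)^T) 0 i = (i \in Z)%:R * (dot c (a i) - dot c (a i1)).
  rewrite mxE -dotNr -dotDr /dot mulr_sumr; apply: eq_bigr => j _.
  by rewrite !mxE mulrCA.
have -> : (restr R Z @: aff_space)%VS = (<[ind Z]> + G)%VS.
  apply/vspaceP => f; apply/memv_imgP/memv_addP.
    move=> [g /aff_spaceP[c [be gE]] ->].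
    exists ((be + dot c (a i1)) *: ind Z); first by rewrite memvZ// memv_line.
    exists (c *m (differences Z i1)^T); first by rewrite memv_limg_mulmxr submxMl.
    apply/rowP => i; rewrite restrE gE mxE GE !mxE; ring.
  move=> [_ /vlineP[be ->] [g]]; rewrite memv_limg_mulmxr => /submxP[c ->] ->.
  exists (\row_i (dot c (a i) + (be - dot c (a i1)))).
    by apply/aff_spaceP; exists c, (be - dot c (a i1)) => i; rewrite mxE.
  by apply/rowP => i; rewrite restrE mxE GE !mxE; ring.
rewrite dimv_disjoint_sum.
  rewrite dim_vline -supp0 supp_ind /G /directions !dim_limg_mulmxr mxrank_tr.
  suff -> : Z != finset.set0 by [].
  by apply/set0Pn; exists i1.
apply/eqP; rewrite -subv0; apply/subvP => f; rewrite memv_cap memv0.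
case/andP=> /vlineP[t ->]; rewrite memv_limg_mulmxr => /submxP[c /rowP/(_ i1)].
by rewrite GE subrr mulr0 !mxE i1Z mulr1 => ->; rewrite scale0r.
Qed.

Lemma aff_hull_hull Z i1 : i1 \in Z -> affine_hull (hull Z) =
  [set a i1 + u | u in [set u | u \in directions Z i1]]%classic.
Proof.
move=> i1Z; apply/seteqP; split => y.
  move=> [k [w [x [hx w1 ->]]]]; exists (\sum_j w j *: (x j - a i1)) => /=; last first.
    under eq_bigr do rewrite scalerBr.
    by rewrite sumrB -scaler_suml w1 scale1r addrC subrK.
  apply: memv_suml => j _; apply: memvZ; have [k' [v [z [hz _ v1 ->]]]] := hx j.
  have -> : \sum_i v i *: z i - a i1 = \sum_i v i *: (z i - a i1).
    under [RHS]eq_bigr do rewrite scalerBr.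
    by rewrite sumrB -scaler_suml v1 scale1r.
  apply: memv_suml => l _; apply: memvZ; have [i /= iZ <-] := hz l.
  rewrite memv_limg_mulmxr.
  have -> : a i - a i1 = row i (differences Z i1) by rewrite rowK iZ scale1r.
  exact: row_sub.
move=> [u /=]; rewrite memv_limg_mulmxr => /submxP[c ->] <-.
(* Outside Z the rows are zero, so [a i1] can stand in for [a i]. *)
pose x i := if i \in Z then a i else a i1.
exists N.+1, (fun j => if unlift ord0 j is Some i then c 0 i else 1 - \sum_i c 0 i),
  (fun j => if unlift ord0 j is Some i then x i else a i1).
have xZ i : hull Z (x i).
  by apply: sub_convex_hull; rewrite /x; case: ifP => iZ; [exists i | exists i1].
split.
- move=> j; case: unliftP => [i _|_]; first exact: xZ.
  by apply: sub_convex_hull; exists i1.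
- rewrite big_ord_recl unlift_none.
  by rewrite [X in _ + X](eq_bigr (fun i => c 0 i)) ?subrK// => i _; rewrite liftK.
- rewrite big_ord_recl unlift_none mulmx_sum_row.
  rewrite [X in _ = _ + X](eq_bigr (fun i => c 0 i *: x i)); last first.
    by move=> i _; rewrite liftK.
  rewrite scalerBl scale1r -addrA; congr (_ + _).
  rewrite scaler_suml addrC -sumrB; apply: eq_bigr => i _.
  rewrite rowK -scalerBr /x; case: (i \in Z); first by rewrite scale1r.
  by rewrite scale0r subrr.
Qed.

Lemma has_dim_hull Z i1 e : i1 \in Z ->
  has_dim (hull Z) e <-> \dim (restr R Z @: aff_space) = e.+1.
Proof.
move=> i1Z; rewrite (dim_restr i1Z); split; last first.
  by move=> [<-]; exists (a i1), (directions Z i1); rewrite (aff_hull_hull i1Z).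
move=> [x0 [U [<-]]]; rewrite (aff_hull_hull i1Z) => hE; congr _.+1.
congr (\dim _); have x0U : exists2 u0, u0 \in directions Z i1 & x0 = a i1 + u0.
  have : [set x0 + u | u in [set u | u \in U]]%classic x0.
    by exists 0; rewrite /= ?mem0v ?addr0.
  by rewrite -hE => -[u0 /= hu <-]; exists u0.
have [u0 hu0 x0E] := x0U.
apply/vspaceP => u; apply/idP/idP => hu.
  have : [set a i1 + u | u in [set u | u \in directions Z i1]]%classic (a i1 + (u0 + u)).
    by exists (u0 + u) => //=; rewrite memvD.
  by rewrite hE addrA -x0E => -[u' /= hu' /addrI <-].
have : [set x0 + u | u in [set u | u \in U]]%classic (x0 + u) by exists u.
rewrite -hE x0E -addrA => -[u' /= hu' /addrI e'].
by rewrite -[u](addKr u0) -e' memvD// memvN.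
Qed.

End Points.

(** * From a 2-level polytope to a binary space *)

Section TwoLevel.
Local Open Scope ring_scope.
Context {R : realType} {n N : nat}.
Local Notation ind := (@ind R N).
Implicit Types (Z S T : {set 'I_N}) (f g : 'rV[R]_N) (c : 'rV[R]_n) (F : set 'rV[R]_n).

Let full : {set 'I_N} := [set: 'I_N]%SET.

Variables (P : set 'rV[R]_n) (a : 'I_N -> 'rV[R]_n) (d : nat).
Hypotheses (a_inj : injective a) (vertP : vertices P = range a)
  (hP : polytope P) (dimP : has_dim P d.+1) (levelP : two_level P).

Let V := aff_space a.

Lemma has_dim_nonempty (A : set 'rV[R]_n) e : has_dim A e -> (A !=set0)%classic.
Proof.
move=> [x0 [U [_ AE]]]; have : affine_hull A x0.
  by rewrite AE; exists 0; rewrite /= ?mem0v ?addr0.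
move=> [[|k] [w [x [Ax w1 _]]]]; last by exists (x ord0).
by move: w1; rewrite big_ord0 => /eqP; rewrite eq_sym oner_eq0.
Qed.

Let range_full : (range a = a @` [set` full])%classic.
Proof. by congr (a @` _)%classic; apply/seteqP; split => i //=; rewrite inE. Qed.

Let PE : P = hull a full.
Proof. by rewrite (polytope_vertices hP) vertP range_full. Qed.

Let aP i : P (a i).
Proof. by rewrite PE; apply: sub_convex_hull; exists i => //=; rewrite inE. Qed.

Lemma restr_full : (restr R full @: V)%VS = V.
Proof.
apply/vspaceP => f; apply/memv_imgP/idP => [[g gV ->]|fV].
  by rewrite restr_id ?finset.subsetT.
by exists f; rewrite ?restr_id ?finset.subsetT.
Qed.

Lemma hull_inhabited Z : (hull a Z !=set0)%classic -> exists i, i \in Z.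
Proof. by move=> [x /hull_nonempty[_ [i iZ _]]]; exists i. Qed.

Lemma dim_aff_space : \dim V = d.+2.
Proof.
have [i0 i0f] : exists i, i \in full.
  by apply: hull_inhabited; rewrite -PE; apply: has_dim_nonempty dimP.
by rewrite -restr_full; apply/(has_dim_hull a d.+1 i0f); rewrite -PE.
Qed.

Definition tight F : {set 'I_N} := [set i | `[< F (a i) >]]%SET.

Lemma in_tight F i : (i \in tight F) = `[< F (a i) >].
Proof. by rewrite inE. Qed.

Lemma face_hull F : face P F -> F = hull a (tight F).
Proof.
rewrite PE => /face_convex_hull {1}->; congr convex_hull; apply/seteqP; split => x.
  by move=> [[i _ <-] Fi]; exists i => //=; rewrite in_tight; apply/asboolP.
move=> [i /= + <-]; rewrite in_tight => /asboolP Fi; split => //.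
by exists i => //=; rewrite inE.
Qed.

Definition vanishing Z := (V :&: lker (restr R Z))%VS.

Lemma mem_vanishing Z f : (f \in vanishing Z) = (f \in V) && (supp f \subset ~: Z)%SET.
Proof. by rewrite memv_cap memv_ker restr_eq0 -[in RHS]finset.disjoints_subset. Qed.

(** Rank-nullity turns codimension 1 into a line of functions vanishing on the facet. *)
Lemma facet_vanishing F : facet P F ->
  [/\ exists i, i \in tight F, exists i, i \notin tight F & \dim (vanishing (tight F)) = 1%N].
Proof.
move=> [/face_hull FE [e [Pe Fe]]].
have [i0 i0Z] : exists i, i \in tight F.
  by apply: hull_inhabited; rewrite -FE; apply: has_dim_nonempty Fe.
have dZ : \dim (restr R (tight F) @: V) = e.+1.
  by apply/(has_dim_hull a e i0Z); rewrite -FE.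
have dV : \dim V = e.+2.
  by rewrite -restr_full; apply/(@has_dim_hull _ _ _ a full i0 e.+1); rewrite ?inE -?PE.
have d1 : \dim (vanishing (tight F)) = 1%N.
  by have := limg_ker_dim (restr R (tight F)) V; rewrite dZ dV -[e.+2]add1n => /addIn.
split=> //; first by exists i0.
apply/existsP; apply: contraT => /existsPn h.
have tf : tight F = full by apply/setP => i; rewrite !inE; have := h i; rewrite negbK inE => ->.
by move: dZ; rewrite tf restr_full dV => /eqP; rewrite eqn_leq ltnn.
Qed.

(** Since P is 2-level, the functional defining the facet has the constant value b + [dot c v] at
    the vertices off it; an affine rescaling makes the two values 0 and 1. *)
Lemma facet_ind F : facet P F -> ind (~: tight F)%SET \in V.
Proof.
move=> fF; have [[i0 i0F] [i1 i1F] d1] := facet_vanishing fF.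
have [[c [b [cb FE]]] _] := fF.
have tE i : i \in tight F <-> dot c (a i) = b.
  by rewrite in_tight FE; split => [/asboolP[]|e] //; apply/asboolP; split; first exact: aP.
have c0 : c != 0.
  apply: contraNneq i1F => c0; apply/tE; have /tE := i0F.
  by rewrite c0 !dot0l.
have [|H' [_ [v HE] sub]] := levelP (H := [set x | dot c x = b]%classic).
  by split; [exists c, b | rewrite -FE].
have val i : i \notin tight F -> dot c (a i) = b + dot c v.
  move=> iF; have : vertices P (a i) by rewrite vertP; exists i.
  move=> /sub[/= e|]; first by case/negP: iF; apply/tE.
  by rewrite HE => -[x /= <- <-]; rewrite dotDr.
have be0 : dot c v != 0.
  by apply/eqP => e; case/negP: (i1F); apply/tE; rewrite val// e addr0.
apply/aff_spaceP; exists ((dot c v)^-1 *: c), (- (dot c v)^-1 * b) => i.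
rewrite indE inE dotZl; case: (boolP (i \in tight F)) => iF /=.
  by move/tE: iF => ->; rewrite mulNr subrr.
by rewrite val// mulrDr mulVf// mulNr addrAC subrr add0r.
Qed.

Lemma facet_complement f : f \in V -> (forall i, 0 <= f 0 i) ->
    (exists i, f 0 i = 0) -> \dim (vanishing (~: supp f)%SET) = 1%N ->
  facet P (hull a (~: supp f)%SET) /\ tight (hull a (~: supp f)%SET) = (~: supp f)%SET.
Proof.
move=> fV f0 [i0 fi0] d1; have [c [be fE]] := (aff_spaceP a f).1 fV.
set Z := (~: supp f)%SET.
have inZ i : (i \in Z) = (f 0 i == 0) by rewrite !inE negbK.
pose F := (P `&` [set x | dot (- c) x = be])%classic.
have faceF : face P F.
  exists (- c), be; split => // x Px.
  suff : 0 <= dot c x + be by rewrite dotNl; lra.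
  move: Px; rewrite PE; apply: hull_affine_ge0 => _ [i _ <-].
  by rewrite -fE.
have tF : tight F = Z.
  apply/setP => i; rewrite in_tight inZ; apply/asboolP/eqP => [[_ /=]|e].
    by rewrite fE dotNl; lra.
  by split => //=; move: e; rewrite fE dotNl; lra.
have FZ : F = hull a Z by rewrite (face_hull faceF) tF.
rewrite -FZ; split => //; split => //; exists d; split => //.
have i0Z : i0 \in Z by rewrite inZ fi0.
rewrite FZ; apply/(has_dim_hull a d i0Z).
have := limg_ker_dim (restr R Z) V; rewrite -/(vanishing Z) d1 dim_aff_space.
by rewrite add1n => -[].
Qed.

(** Reduce to a function f of inclusion-minimal support. If f has a zero, minimality leaves only
    multiples of f vanishing on its zero set, which is therefore a facet, and [facet_ind] applies;
    if not, the full set will do. *)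
Lemma aff_binary_space : binary_space full V.
Proof.
split; [by move=> f _; apply: finset.subsetT | exact: ind_full |].
move=> f; have [k] := ubnP #|supp f|; elim: k => // k IH in f *.
rewrite ltnS => fk fV fn0 f0.
have [[g [gV gn0 g0 gf]]|none] := pselect (exists g,
    [/\ g \in V, g != 0, forall i, 0 <= g 0 i & supp g \proper supp f]).
  have [|S [SV S0 Sg]] := IH g _ gV gn0 g0.
    by apply: leq_trans fk; apply: proper_card.
  by exists S; split => //; apply: fintype.subset_trans Sg (proper_sub gf).
have fs0 : supp f != finset.set0 by rewrite supp0.
have [[i0 fi0]|pos] := pselect (exists i, f 0 i = 0); last first.
  exists full; split; rewrite ?mem_sets ?ind_full//.
    by have [i _] := set0Pn _ fs0; apply/set0Pn; exists i; rewrite inE.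
  by apply/fintype.subsetP => i _; rewrite inE; apply/eqP => fi; apply: pos; exists i.
have vE : vanishing (~: supp f)%SET = <[f]>%VS.
  apply/vspaceP => h; rewrite mem_vanishing finset.setCK; apply/andP/vlineP; last first.
    move=> [t ->]; rewrite memvZ//; split => //; apply: supp_subP => i ni.
    by rewrite mxE (supp_out ni) mulr0.
  move=> [hV hf]; have [j0 j0f] := set0Pn _ fs0.
  (* The largest ratio is the least multiple of f dominating h; the difference has a new zero where
     it is attained. *)
  pose q i := h 0 i / f 0 i; pose i1 := [arg max_(i > j0 in supp f) q i]%O.
  have [i1f i1max] : i1 \in supp f /\ forall i, i \in supp f -> q i <= q i1.
    by rewrite /i1; case: Order.TotalTheory.arg_maxP => // i iS imax; split.
  exists (q i1); apply/eqP; rewrite -subr_eq0 -oppr_eq0 opprB; apply/negPn/negP => gn0.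
  apply: none; exists (q i1 *: f - h).
  have fpos i : i \in supp f -> 0 < f 0 i by rewrite inE lt_def f0 andbT.
  split => //; first by rewrite memvB// memvZ.
    move=> i; rewrite !mxE; case: (boolP (i \in supp f)) => iF.
      by rewrite subr_ge0 -ler_pdivrMr ?fpos// i1max.
    by rewrite (supp_out iF) (supp_sub_out hf iF) mulr0 subrr.
  apply/properP; split.
    apply: supp_subP => i iF.
    by rewrite !mxE (supp_out iF) (supp_sub_out hf iF) mulr0 subrr.
  exists i1 => //; rewrite inE !mxE /q divfK ?subrr ?eqxx//.
  by rewrite inE in i1f.
have [|fF tF] := facet_complement fV f0 (ex_intro _ i0 fi0).
  by rewrite vE dim_vline fn0.
exists (supp f); split => //.
by rewrite mem_sets -[supp f]finset.setCK -tF facet_ind.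
Qed.

(* Nonnegative functions are conic combinations of sets, so an affine function
   exposing the vertex a i would not separate it from a j. *)
Lemma aff_separated : separated full V.
Proof.
move=> i j _ _ eqS; apply: contrapT => ij.
have : vertices P (a i) by rewrite vertP; exists i.
move=> [c [b [cb iE]]].
have ci : dot c (a i) = b by have : [set a i]%classic (a i) by []; rewrite iE => -[].
pose f : 'rV[R]_N := \row_k (b - dot c (a k)).
have fV : f \in V by apply/aff_spaceP; exists (- c), b => k; rewrite mxE dotNl addrC.
have f0 k : 0 <= f 0 k by rewrite mxE subr_ge0 cb.
have [t _ fE] := binary_cone aff_binary_space fV f0.
have fij : f 0 i = f 0 j.
  by rewrite fE !summxE; apply: eq_bigr => S SV; rewrite !mxE (eqS S SV).
have : [set a i]%classic (a j).
  rewrite iE; split => //=; move: fij; rewrite !mxE ci subrr => /eqP.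
  by rewrite eq_sym subr_eq0 => /eqP.
by move=> /a_inj e; apply: ij.
Qed.

Lemma facet_minimal_set F : facet P F -> (~: tight F)%SET \in minimal_sets V.
Proof.
move=> fF; have [[i0 i0F] [i1 i1F] d1] := facet_vanishing fF.
have indF := facet_ind fF; set S := (~: tight F)%SET in indF *.
have S0 : S != finset.set0 by apply/set0Pn; exists i1; rewrite inE.
rewrite inE mem_sets indF S0 /=; apply/forall_inP => T TV; apply/implyP => /andP[T0 TS].
have inv U : U \in sets V -> (U \subset S)%SET -> ind U \in vanishing (tight F).
  by rewrite mem_sets mem_vanishing supp_ind => -> ->.
have vE : vanishing (tight F) = <[ind S]>%VS.
  apply/eqP; rewrite eq_sym eqEdim d1 dim_vline -supp0 supp_ind S0 andbT.
  by rewrite -memvE inv// mem_sets.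
have := inv T TV TS; rewrite vE => /vlineP[t tE].
have t0 : t != 0.
  by apply: contraNneq T0 => t0; rewrite -[T](supp_ind R) tE t0 scale0r supp0.
rewrite -[T](supp_ind R) tE; apply/eqP/setP => i.
by rewrite inE mxE indE mulf_eq0 (negbTE t0) /= pnatr_eq0 eqb0 negbK.
Qed.

Lemma num_facets_le : (num_facets P <= #|minimal_sets V|)%N.
Proof.
rewrite /num_facets; set E := fset_set _.
have EP F : F \in E -> facet P F.
  by rewrite in_fset_set; [move/set_mem | exact: finite_facets].
pose phi F := (~: tight F)%SET.
have phi_inj : {in E &, injective phi}.
  move=> F G /EP[fF _] /EP[fG _] /(congr1 (fun Z => ~: Z)%SET).
  by rewrite !finset.setCK => e; rewrite (face_hull fF) (face_hull fG) e.
have u : uniq (map phi E) by rewrite map_inj_in_uniq ?fset_uniq.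
have -> : #|` E| = size (map phi E) by rewrite size_map.
rewrite -(card_uniqP u); apply: subset_leq_card; apply/fintype.subsetP => _ /mapP[F FE ->].
exact/facet_minimal_set/EP.
Qed.

End TwoLevel.

(** * Affine isomorphisms from affine coordinates *)

Section Isomorphisms.
Local Open Scope ring_scope.
Context {R : realType} {n N d : nat}.
Local Notation ind := (@ind R N).

Let full : {set 'I_N} := [set: 'I_N]%SET.

Lemma affine_combination m p (A : 'M[R]_(m, p)) (b : 'rV[R]_p) k (w : 'I_k -> R)
    (x : 'I_k -> 'rV[R]_m) : \sum_i w i = 1 ->
  (\sum_i w i *: x i) *m A + b = \sum_i w i *: (x i *m A + b).
Proof.
move=> w1; rewrite mulmx_suml -[in LHS](scale1r b) -w1 scaler_suml -big_split /=.
by apply: eq_bigr => i _; rewrite scalerDr scalemxAl.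
Qed.

(** The [psi k] extend to an affine map of the ambient space. It is injective on the hull, though
    possibly not outside, because each ambient coordinate is an affine function on the points and
    hence a combination of 1 and the [psi k]. *)
Lemma coordinates_isomorphic (a : 'I_N -> 'rV[R]_n) (psi : 'I_d -> 'rV[R]_N)
    (W : set 'rV[R]_d) :
    affine_coordinates full (aff_space a) psi ->
    (forall i, W (\row_k psi k 0 i)) ->
    (forall y, W y -> exists i, y = \row_k psi k 0 i) ->
  affinely_isomorphic (hull a full) (convex_hull W).
Proof.
move=> [psiV span] psiW Wpsi.
have [c cE] : exists c : 'I_d -> 'rV[R]_n * R,
    forall k i, psi k 0 i = dot (c k).1 (a i) + (c k).2.
  apply: (@fin_all_exists _ _ (fun k (c : 'rV[R]_n * R) =>
    forall i, psi k 0 i = dot c.1 (a i) + c.2)) => k.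
  by have [c [be h]] := (aff_spaceP a (psi k)).1 (psiV k); exists (c, be).
pose A : 'M[R]_(n, d) := \matrix_(j, k) (c k).1 0 j.
pose b : 'rV[R]_d := \row_k (c k).2.
pose Phi x := x *m A + b.
have PhiE x k : Phi x 0 k = dot (c k).1 x + (c k).2.
  rewrite !mxE; congr (_ + _); apply: eq_bigr => j _.
  by rewrite mxE mulrC.
have Phia i : Phi (a i) = \row_k psi k 0 i.
  by apply/rowP => k; rewrite PhiE mxE cE.
have coordE j : exists al : 'I_d.+1 -> R, forall x, hull a full x ->
    x 0 j = al ord0 + \sum_k al (lift ord0 k) * Phi x 0 k.
  pose f : 'rV[R]_N := \row_i a i 0 j.
  have fV : f \in aff_space a.
    by apply/aff_spaceP; exists (delta_mx 0 j), 0 => i; rewrite mxE dot_delta addr0.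
  pose X : d.+1.-tuple 'rV[R]_N := [tuple of ind full :: mktuple psi].
  have fX : f \in <<X>>%VS by apply: (subvP span).
  exists (fun k => coord X k f).
  have fE i : a i 0 j = coord X ord0 f + \sum_k coord X (lift ord0 k) f * Phi (a i) 0 k.
    have /rowP/(_ i) := coord_span fX; rewrite summxE big_ord_recl !mxE inE mulr1 => ->.
    congr (_ + _); apply: eq_bigr => k _.
    by rewrite mxE -tnth_nth tnthS tnth_mktuple Phia mxE.
  move=> x [k [w [y [yA _ w1 xE]]]].
  rewrite {1}xE summxE /Phi xE affine_combination//.
  under [X in _ = _ + X]eq_bigr do rewrite summxE mulr_sumr.
  rewrite exchange_big -[coord X ord0 f]mul1r -w1 mulr_suml -big_split /=.
  apply: eq_bigr => l _; rewrite mxE; have [i _ <-] := yA l.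
  rewrite fE mulrDr mulr_sumr; congr (_ + _); apply: eq_bigr => k' _.
  by rewrite mulrCA; congr (_ * _); rewrite [RHS]mxE.
exists A, b; split.
- move=> x [k [w [y [yA w0 w1 ->]]]]; exists k, w, (fun l => Phi (y l)).
  split => //; last exact: affine_combination.
  by move=> l; have [i _ <-] := yA l; rewrite Phia.
- move=> x y /set_mem hx /set_mem hy e; apply/rowP => j.
  have [al alE] := coordE j; rewrite !alE//.
  by congr (_ + _); apply: eq_bigr => k _; rewrite /Phi e.
- move=> y [k [w [z [zW w0 w1 ->]]]].
  have [i iE] := fin_all_exists (fun l => Wpsi (z l) (zW l)).
  exists (\sum_l w l *: a (i l)).
    by exists k, w, (a \o i); split => // l; exists (i l); rewrite //= inE.
  rewrite affine_combination//; apply: eq_bigr => l _.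
  by rewrite -/(Phi _) Phia -iE.
Qed.

Lemma cube_hull : cube R d =
  convex_hull [set y | exists U : {set 'I_d}, y = \row_k (k \in U)%:R]%classic.
Proof.
pose v (U : {set 'I_d}) : 'rV[R]_d := \row_k (k \in U)%:R.
apply/seteqP; split => [x xc|x [m [w [y [yU w0 w1 ->]]]] k]; last first.
  have yk l : 0 <= y l 0 k <= 1.
    have [U ->] := yU l; rewrite mxE.
    by case: (k \in U); rewrite ?lexx ?ler01.
  rewrite summxE; apply/andP; split.
    by apply: sumr_ge0 => l _; rewrite mxE mulr_ge0//; case/andP: (yk l).
  rewrite -w1; apply: ler_sum => l _; rewrite mxE ler_piMr//.
  by case/andP: (yk l).
have [hx|[c [be [h1 h2]]]] := hull_separation [seq v U | U <- enum {set 'I_d}] x.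
  by apply: convex_hull_mono hx => y /= /mapP[U _ ->]; exists U.
exfalso; move: h2; rewrite ltNge => /negP; apply.
(* The vertex of the cube at which c is smallest. *)
pose U := [set k | c 0 k < 0]%SET.
have := h1 (v U) (map_f v _); rewrite mem_enum => /(_ isT) /le_trans; apply.
rewrite lerD2r; apply: ler_sum => k _; rewrite mxE inE.
have /andP[x0 x1] := xc k; case: ltP => ck; last by rewrite mulr0 mulr_ge0.
by rewrite mulr1; nra.
Qed.

Variable (a : 'I_N -> 'rV[R]_n).

Lemma cube_like_isomorphic : cube_like full (aff_space a) d ->
  affinely_isomorphic (hull a full) (cube R d).
Proof.
move=> [Y [coordY onto]]; rewrite cube_hull.
apply: coordinates_isomorphic coordY _ _.
  move=> i; exists [set k | i \in Y k]%SET; apply/rowP => k.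
  by rewrite !mxE inE.
move=> _ [U ->]; have [i _ iE] := onto U; exists i; apply/rowP => k.
by rewrite !mxE iE.
Qed.

Lemma cross_like_isomorphic : cross_like full (aff_space a) d ->
  affinely_isomorphic (hull a full) (cross_polytope R d).
Proof.
move=> [psi [coordpsi into onto]].
have signE k (e : bool) i : (forall k', psi k' 0 i = (-1) ^+ e * (k == k')%:R) ->
    \row_k' psi k' 0 i = (-1) ^+ e *: delta_mx 0 k.
  by move=> h; apply/rowP => k'; rewrite !mxE h eqxx eq_sym.
apply: coordinates_isomorphic coordpsi _ _.
  move=> i; have [k [e h]] := into i (finset.in_setT i); exists k.
  rewrite (signE _ _ _ h); case: e {h}; first by right; rewrite expr1 scaleN1r.
  by left; rewrite expr0 scale1r.
move=> _ [k [->|->]].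
  have [i _ h] := onto k false; exists i.
  by rewrite (signE _ _ _ h) expr0 scale1r.
have [i _ h] := onto k true; exists i.
by rewrite (signE _ _ _ h) expr1 scaleN1r.
Qed.

End Isomorphisms.

Theorem theorem2 (R : realType) (d : nat) (hd : (1 < d)%N)
    (n : nat) (P : set 'rV[R]_n)
    (hP : polytope P) (hdim : has_dim P d) (h2 : two_level P)
    (hcube : ~ affinely_isomorphic P (cube R d))
    (hcross : ~ affinely_isomorphic P (cross_polytope R d)) :
  (num_vertices P * num_facets P <= (d - 1) * 2 ^ (d + 1) + 8 * (d - 1))%N.
Proof.
case: d hd hdim hcube hcross => // d hd hdim hcube hcross.
have finV := finite_vertices hP.
pose s := enum_fset (fset_set (vertices P)).
pose a i := tnth (in_tuple s) i.
have a_inj : injective a by apply/tuple_uniqP; exact: fset_uniq.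
have vertP : vertices P = range a.
  apply/seteqP; split => [x vx|_ [i _ <-]].
    have /tnthP[i ->] : x \in in_tuple s.
      by rewrite /= in_fset_set//; apply/mem_set.
    by exists i.
  have : a i \in in_tuple s by apply: mem_tnth.
  by rewrite /= in_fset_set// => /set_mem.
have PE : P = hull a [set: 'I_(size s)]%SET.
  rewrite {1}(polytope_vertices hP) vertP; congr convex_hull.
  by apply/seteqP; split => [_ [i _ <-]|_ [i _ <-]]; exists i; rewrite //= inE.
have [bd|c|c] := facet_product (aff_binary_space vertP hP hdim h2)
  (aff_separated a_inj vertP hP hdim h2) (dim_aff_space vertP hP hdim) hd.
- apply: leq_trans bd; rewrite cardsT card_ord leq_mul2l; apply/orP; right.
  exact: num_facets_le.
- by case: hcube; rewrite PE; apply: cube_like_isomorphic.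
- by case: hcross; rewrite PE; apply: cross_like_isomorphic.
Qed.
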